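(* Let $d\geq 1$. If an analytic set $\mathscr{A}\subseteq (0,1)^{d}$ cannot be covered by an $F_{\sigma}$, purely unrectifiable set, then a typical $f\in\operatorname{Lip}_{1}([0,1]^{d})$ has points of differentiability in $\mathscr{A}$; moreover, for a typical $f$ such a point $x\in\mathscr{A}$ may be taken so that $f$ is differentiable at $x$ with $\|\nabla f(x)\|=1$. That is, the set of $f\in\operatorname{Lip}_1([0,1]^d)$ for which there exists $x\in\mathscr{A}$ such that $f$ is differentiable at $x$ with $\|\nabla f(x)\|=1$ is residual in $\operatorname{Lip}_1([0,1]^d)$.
   Context: $\operatorname{Lip}_{1}([0,1]^{d})$ denotes the set of all functions $f\colon[0,1]^d\to\mathbb{R}$ with Lipschitz constant at most $1$, viewed as a complete metric space with the supremum metric. ''Typical'' means: the set of functions with the property is residual (complement meagre). A Lipschitz curve is a Lipschitz map $\gamma\colon I\to\mathbb{R}^d$, $I\subseteq\mathbb{R}$ a closed interval, whose derivative is bounded away from zero in norm almost everywhere. A set $P\subseteq\mathbb{R}^d$ is purely unrectifiable if for every Lipschitz curve $\gamma\colon[0,1]\to\mathbb{R}^d$ the set $\gamma^{-1}(P)$ has Lebesgue measure zero. *)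

(* Defs.v *)
From HB Require Import structures.
From mathcomp Require Import all_boot all_order all_algebra.
From mathcomp Require Import all_classical all_reals.
From mathcomp Require Import topology normedtype measure lebesgue_measure.
From mathcomp Require Import Rstruct Rstruct_topology.
From Stdlib Require Import Rdefinitions.

Unset Printing Implicit Defensive.

Import Order.TTheory GRing.Theory Num.Theory.
Local Open Scope classical_set_scope.
Local Open Scope ring_scope.

Notation pt d := 'rV[R]_d.

Definition dotp {d : nat} (u v : pt d) : R := \sum_(i < d) u ord0 i * v ord0 i.
Definition enorm {d : nat} (u : pt d) : R := Num.sqrt (dotp u u).

Definition cube (d : nat) : set (pt d) :=
  [set x | forall i : 'I_d, 0 <= x ord0 i <= 1].
Definition open_cube (d : nat) : set (pt d) :=
  [set x | forall i : 'I_d, 0 < x ord0 i < 1].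

(* Lip_1([0,1]^d): functions whose restriction to [0,1]^d is 1-Lipschitz
   (Euclidean norm).  Only the values on [0,1]^d matter. *)
Definition Lip1 (d : nat) : set (pt d -> R) :=
  [set f | forall x y, cube d x -> cube d y -> `|f x - f y| <= enorm (x - y)].

Definition supdist_lt (d : nat) (f g : pt d -> R) (r : R) : Prop :=
  exists2 r' : R, r' < r & forall x, cube d x -> `|f x - g x| <= r'.

Definition lip_closure (d : nat) (S : set (pt d -> R)) : set (pt d -> R) :=
  [set g | Lip1 d g /\ forall e : R, 0 < e ->
     exists h, [/\ Lip1 d h, S h & supdist_lt d g h e]].

Definition lip_nowhere_dense (d : nat) (S : set (pt d -> R)) : Prop :=
  ~ exists f : pt d -> R, exists2 r : R, 0 < r /\ Lip1 d f &
      (forall g, Lip1 d g -> supdist_lt d f g r -> lip_closure d S g).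

Definition lip_meagre (d : nat) (S : set (pt d -> R)) : Prop :=
  exists N : nat -> set (pt d -> R),
    (forall n, lip_nowhere_dense d (N n)) /\
    (forall f, Lip1 d f -> S f -> exists n, N n f).

Definition lip_residual (d : nat) (S : set (pt d -> R)) : Prop :=
  lip_meagre d [set f | ~ S f].

Definition has_gradient (d : nat) (f : pt d -> R) (x v : pt d) : Prop :=
  forall e : R, 0 < e -> exists2 delta : R, 0 < delta &
    forall y, enorm (y - x) < delta ->
      `|f y - f x - dotp v (y - x)| <= e * enorm (y - x).

Definition eclosed (d : nat) (C : set (pt d)) : Prop :=
  forall x, (forall e : R, 0 < e -> exists y, C y /\ enorm (x - y) < e) -> C x.

Definition Fsigma (d : nat) (P : set (pt d)) : Prop :=
  exists C : nat -> set (pt d), (forall n, eclosed d (C n)) /\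
    P = \bigcup_n C n.

Definition baire_continuous (d : nat) (g : (nat -> nat) -> pt d) : Prop :=
  forall s : nat -> nat, forall e : R, 0 < e -> exists n : nat,
    forall t : nat -> nat, (forall k : nat, ltn k n -> t k = s k) ->
      enorm (g t - g s) < e.

Definition analytic (d : nat) (A : set (pt d)) : Prop :=
  A = set0 \/ exists g : (nat -> nat) -> pt d,
    baire_continuous d g /\ A = range g.

Definition curve_deriv (d : nat) (gamma : R -> pt d) (t : R) (v : pt d) : Prop :=
  forall e : R, 0 < e -> exists2 delta : R, 0 < delta &
    forall h : R, 0 < `|h| < delta ->
      enorm (h^-1 *: (gamma (t + h) - gamma t) - v) <= e.

Definition lipschitz_curve (d : nat) (gamma : R -> pt d) : Prop :=
  (exists L : R, forall s t : R, `[0, 1]%classic s -> `[0, 1]%classic t ->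
     enorm (gamma s - gamma t) <= L * `|s - t|) /\
  (exists2 c : R, 0 < c &
     (@lebesgue_measure R).-negligible
       (`[0, 1]%classic `\` [set t | exists v, curve_deriv d gamma t v /\ c <= enorm v])).

Definition purely_unrectifiable (d : nat) (P : set (pt d)) : Prop :=
  forall gamma : R -> pt d, lipschitz_curve d gamma ->
    (@lebesgue_measure R).-negligible (`[0, 1]%classic `&` (gamma @^-1` P)).

(* Main.v *)
Require Import Defs.
From mathcomp Require Import all_boot all_order all_algebra.
From mathcomp Require Import all_classical all_reals.
From mathcomp Require Import Rstruct.
From Stdlib Require Import Rdefinitions.
From mathcomp Require Import topology normedtype ereal sequences derive.
From mathcomp Require Import measure measurable_realfun lebesgue_measure.
From mathcomp Require Import numfun lebesgue_integral.
From mathcomp Require Import Rstruct_topology ring lra zify.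

Set Implicit Arguments.
Unset Strict Implicit.
Unset Printing Implicit Defensive.

Import numFieldNormedType.Exports.
Import Order.TTheory GRing.Theory Num.Theory.
Local Delimit Scope nat_scope with N.
Local Open Scope classical_set_scope.
Local Open Scope ring_scope.
(* Otherwise arguments of type [R] are parsed in [R_scope], with [Rmult] for [*]. *)
Local Bind Scope ring_scope with R.

(** Call a closed set null along a set [D] of velocities if every Lipschitz curve spends almost no
time in it while moving with velocity in [D].  Splitting [D] into finitely many narrow cones, and
removing from [A = g (nat -> nat)] the cylinders whose images are covered by countably many closed
sets null along [D], one always finds a piece of [A], of arbitrarily small diameter, and a narrow
cone such that the closure of every portion of the piece meets some curve with velocities in the
cone in positive measure.

The second player of the Banach-Mazur game in [Lip1] uses this as follows.  Suppose that near the
current piece all remaining functions are close to an affine function with unit gradient [e].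
Along a short curve fragment in the closure of the piece, with directions nearly [e] and with high
density, such a function [f] grows at almost the maximal rate, so by the rising sun lemma it does
so from some point [x] of the fragment at all scales, forwards and backwards.  A 1-Lipschitz
function with this property is nearly affine around [x] at all these scales.  Moving [f] towards
the affine function through [x] by at most [eta] makes it exactly affine near [x] without spoiling
the approximation elsewhere; then the piece and the cone are refined.  The pieces shrink to a point
of [A], the axes of the cones converge to a unit vector, and every function compatible with the
play has that vector as its gradient at that point. *)

Section Decode.
Variables (T : countType) (x0 : T).

Definition decode (n : nat) : T := odflt x0 (unpickle n).

Lemma pickle_decode : cancel pickle decode.
Proof. by move=> x; rewrite /decode pickleK. Qed.

End Decode.

(** * The Euclidean norm *)

Section EuclideanNorm.
Variable d : nat.
Implicit Types (a m : R) (u v w x y z : pt d).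

Lemma dotpC u v : dotp u v = dotp v u.
Proof. by apply: eq_bigr => i _; rewrite mulrC. Qed.

Lemma dotpDl u v w : dotp (u + v) w = dotp u w + dotp v w.
Proof. by rewrite -big_split; apply: eq_bigr => i _; rewrite mxE mulrDl. Qed.

Lemma dotpZl a u w : dotp (a *: u) w = a * dotp u w.
Proof. by rewrite mulr_sumr; apply: eq_bigr => i _; rewrite mxE mulrA. Qed.

Lemma dotpNl u w : dotp (- u) w = - dotp u w.
Proof. by rewrite -scaleN1r dotpZl mulN1r. Qed.

Lemma dotpBl u v w : dotp (u - v) w = dotp u w - dotp v w.
Proof. by rewrite dotpDl dotpNl. Qed.

Lemma dotp0l u : dotp 0 u = 0.
Proof. by rewrite -(scale0r 0) dotpZl mul0r. Qed.

Lemma dotpDr u v w : dotp w (u + v) = dotp w u + dotp w v.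
Proof. by rewrite dotpC dotpDl !(dotpC _ w). Qed.

Lemma dotpZr a u w : dotp w (a *: u) = a * dotp w u.
Proof. by rewrite dotpC dotpZl dotpC. Qed.

Lemma dotpNr u w : dotp w (- u) = - dotp w u.
Proof. by rewrite dotpC dotpNl dotpC. Qed.

Lemma dotpBr u v w : dotp w (u - v) = dotp w u - dotp w v.
Proof. by rewrite dotpDr dotpNr. Qed.

Lemma dotp_ge0 u : 0 <= dotp u u.
Proof. by apply: sumr_ge0 => i _; rewrite -expr2 sqr_ge0. Qed.

Lemma enorm_ge0 u : 0 <= enorm u.
Proof. exact: sqrtr_ge0. Qed.

Lemma sqr_enorm u : enorm u ^+ 2 = dotp u u.
Proof. by rewrite sqr_sqrtr // dotp_ge0. Qed.

Lemma enorm0 : enorm (0 : pt d) = 0.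
Proof. by rewrite /enorm dotp0l sqrtr0. Qed.

Lemma enorm_eq0 u : enorm u = 0 -> u = 0.
Proof.
move=> u0; have /psumr_eq0P coord0 : dotp u u = 0 by rewrite -sqr_enorm u0 expr0n.
apply/rowP => i; rewrite mxE; apply/eqP; rewrite -sqrf_eq0 expr2 coord0 // => j _.
by rewrite -expr2 sqr_ge0.
Qed.

Lemma enorm_gt0 u : (0 < enorm u) = (u != 0).
Proof.
rewrite lt0r enorm_ge0 andbT; congr (~~ _).
by apply/eqP/eqP => [/enorm_eq0|->]; last exact: enorm0.
Qed.

Lemma enormZ a u : enorm (a *: u) = `|a| * enorm u.
Proof. by rewrite /enorm dotpZl dotpZr mulrA sqrtrM ?sqr_ge0// -expr2 sqrtr_sqr. Qed.

Lemma enormZ_unit a u : enorm u = 1 -> enorm (a *: u) = `|a|.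
Proof. by move=> u1; rewrite enormZ u1 mulr1. Qed.

Lemma enorm_normalize u : u != 0 -> enorm ((enorm u)^-1 *: u) = 1.
Proof.
by move=> u0; rewrite enormZ ger0_norm ?invr_ge0 ?enorm_ge0 // mulVf // gt_eqF ?enorm_gt0.
Qed.

Lemma enormN u : enorm (- u) = enorm u.
Proof. by rewrite -scaleN1r enormZ normrN1 mul1r. Qed.

Lemma enorm_distC u v : enorm (u - v) = enorm (v - u).
Proof. by rewrite -enormN opprB. Qed.

Lemma cauchy_schwarz u v : dotp u v <= enorm u * enorm v.
Proof.
have [->|u0] := eqVneq u 0; first by rewrite dotp0l enorm0 mul0r.
have [->|v0] := eqVneq v 0; first by rewrite dotpC dotp0l enorm0 mulr0.
have := dotp_ge0 (enorm v *: u - enorm u *: v).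
rewrite dotpBl !dotpBr !dotpZl !dotpZr -!sqr_enorm (dotpC v u).
have : 0 < enorm u * enorm v by rewrite mulr_gt0 // enorm_gt0.
move: (enorm u) (enorm v) (dotp u v) => a b c; nra.
Qed.

Lemma normr_dotp u v : `|dotp u v| <= enorm u * enorm v.
Proof. by rewrite ler_norml lerNl -dotpNl -{1}(enormN u) !cauchy_schwarz. Qed.

Lemma normr_dotp_unit u v : enorm u = 1 -> `|dotp u v| <= enorm v.
Proof. by move=> u1; have := normr_dotp u v; rewrite u1 mul1r. Qed.

Lemma enormD u v : enorm (u + v) <= enorm u + enorm v.
Proof.
rewrite -(@ler_pXn2r _ 2) ?nnegrE ?addr_ge0 ?enorm_ge0 //.
rewrite sqr_enorm dotpDl !dotpDr -!sqr_enorm (dotpC v u).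
have := cauchy_schwarz u v; nra.
Qed.

Lemma enorm_distD w u v : enorm (u - v) <= enorm (u - w) + enorm (w - v).
Proof. by have := enormD (u - w) (w - v); rewrite addrA subrK. Qed.

Lemma ler_enorm_dist u v : `|enorm u - enorm v| <= enorm (u - v).
Proof.
have := enormD v (u - v); have := enormD u (v - u).
by rewrite !(addrC _ (_ - _)) !subrK (enorm_distC v u) ler_norml; lra.
Qed.

Lemma coord_le_enorm u (i : 'I_d) : `|u ord0 i| <= enorm u.
Proof.
rewrite -(@ler_pXn2r _ 2) ?nnegrE ?enorm_ge0 // sqr_enorm /dotp (bigD1 i) //=.
rewrite real_normK ?num_real // -expr2 lerDl.
by apply: sumr_ge0 => j _; rewrite -expr2 sqr_ge0.
Qed.

Lemma le_enorm u v : (forall i, `|u ord0 i| <= `|v ord0 i|) -> enorm u <= enorm v.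
Proof.
move=> uv; rewrite ler_sqrt ?dotp_ge0 //; apply: ler_sum => i _.
by rewrite -!expr2 -!(real_normK (num_real (_ ord0 i))) lerXn2r ?nnegrE.
Qed.

Lemma enorm_le_coords u m : (forall i, `|u ord0 i| <= m) -> enorm u <= d%:R * m.
Proof.
move=> um; have dm0 : 0 <= d%:R * m.
  rewrite mulr_natl -(card_ord d) -sumr_const.
  by apply: sumr_ge0 => i _; apply: le_trans (um i).
rewrite -(@ler_pXn2r _ 2) ?nnegrE ?enorm_ge0 // sqr_enorm.
apply: (@le_trans _ _ (\sum_(i < d) m ^+ 2)).
  apply: ler_sum => i _; rewrite -expr2 -(real_normK (num_real _)).
  by rewrite lerXn2r ?nnegrE // (le_trans _ (um i)).
rewrite sumr_const card_ord -[leLHS]mulr_natl exprMn ler_wpM2r ?sqr_ge0 //.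
by rewrite -natrX ler_nat expnS expn1; case: (d) => // n; rewrite leq_pmull.
Qed.

End EuclideanNorm.

Section EuclideanTopology.
Variable d : nat.
Implicit Types (C E : set (pt d)) (r : R) (x y : pt d).

Definition eclosure E : set (pt d) :=
  [set x | forall r, 0 < r -> exists y, E y /\ enorm (x - y) < r].

Lemma subset_eclosure E : E `<=` eclosure E.
Proof. by move=> x Ex r r0; exists x; rewrite subrr enorm0. Qed.

Lemma eclosure_closed E : eclosed d (eclosure E).
Proof.
move=> x xcl r r0; have r2 : 0 < r / 2 by lra.
have [y [yE xy]] := xcl _ r2; have [z [Ez yz]] := yE _ r2.
by exists z; split=> //; have := enorm_distD y x z; lra.
Qed.

Lemma eclosure_min E C : eclosed d C -> E `<=` C -> eclosure E `<=` C.
Proof. by move=> Ccl EC x xE; apply: Ccl => r /xE[y [Ey xy]]; exists y; split; [exact: EC|]. Qed.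

Lemma eclosed0 : eclosed d set0.
Proof. by move=> x /(_ 1 ltr01)[y []]. Qed.

Lemma eclosedI C C' : eclosed d C -> eclosed d C' -> eclosed d (C `&` C').
Proof.
by move=> Ccl C'cl x xcl; split; [apply: Ccl|apply: C'cl] => r /xcl[y [[? ?] ?]]; exists y.
Qed.

Lemma eclosed_ball x r : eclosed d [set y | enorm (y - x) <= r].
Proof.
move=> y ycl /=; apply/ler_addgt0Pr => a /ycl[z [zx yz]].
by have := enorm_distD z y x; rewrite /= in zx; lra.
Qed.

Lemma eclosed_cube : eclosed d (cube d).
Proof.
move=> x xcl i; apply/andP; split; rewrite leNgt; apply/negP => lt;
  rewrite -subr_gt0 in lt; have [y [/(_ i)/andP[? ?] xy]] := xcl _ lt;
  have := le_lt_trans (coord_le_enorm _ i) xy; rewrite !mxE ltr_norml => /andP[? ?]; lra.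
Qed.

Lemma ball_finite_net r eps : 0 < eps -> exists s : seq (pt d),
  forall x, enorm x <= r -> exists2 y, y \in s & enorm (x - y) <= eps.
Proof.
move=> eps0; pose h := eps / d.+1%:R.
have h0 : 0 < h by rewrite divr_gt0.
pose M := Num.truncn (2 * r / h).
pose grid (phi : {ffun 'I_d -> 'I_M.+1}) : pt d := \row_i ((phi i)%:R * h - r).
exists [seq grid phi | phi <- enum {: {ffun 'I_d -> 'I_M.+1}}] => x xr.
have coord_itv i : 0 <= x ord0 i + r <= 2 * r.
  by have := le_trans (coord_le_enorm x i) xr; rewrite ler_norml; lra.
pose phi : {ffun 'I_d -> 'I_M.+1} := [ffun i => inord (Num.truncn ((x ord0 i + r) / h))].
exists (grid phi); first by rewrite map_f ?mem_enum.
apply: (@le_trans _ _ (d%:R * h)); last first.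
  by rewrite mulrA ler_pdivrMr // mulrC ler_pM2l // ler_nat.
apply: enorm_le_coords => i; have /andP[xi0 xir] := coord_itv i.
have quo0 : 0 <= (x ord0 i + r) / h by rewrite divr_ge0 // ltW.
have /andP[] := truncn_itv quo0; rewrite ler_pdivlMr // ltr_pdivrMr // -natr1.
rewrite !mxE ffunE inordK => [lo hi|]; first by rewrite ler_norml; lra.
by rewrite ltnS; apply: le_truncn; rewrite ler_pM2r ?invr_gt0.
Qed.

End EuclideanTopology.

(** * Nonexpansive functions *)

Section Clip.
Variable T : realDomainType.
Implicit Types a b c x y z : T.

Definition clip a b x := Num.max a (Num.min x b).

Lemma clip_itv a b x : a <= b -> a <= clip a b x <= b.
Proof. by move=> ab; rewrite /clip le_max lexx ge_max ab ge_min lexx orbT. Qed.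

Lemma clip_id a b x : a <= x <= b -> clip a b x = x.
Proof. by move=> /andP[ax xb]; rewrite /clip min_l ?max_r. Qed.

Lemma clip_nearest a b x z : a <= z <= b -> `|clip a b x - x| <= `|z - x|.
Proof.
rewrite /clip => /andP[az zb]; have := ler_norm (z - x); have := ler_norm (x - z).
rewrite (distrC x z) (ler_norml (_ - x)); move: `|z - x| => r.
by case: (lerP x b) => ?; case: (lerP a _) => ?; lra.
Qed.

Lemma ler_dist_clip a b x a' b' y c :
  `|a - a'| <= c -> `|b - b'| <= c -> `|x - y| <= c -> `|clip a b x - clip a' b' y| <= c.
Proof.
rewrite !ler_norml /clip => ? ? ?.
by case: (lerP x b) => ?; case: (lerP y b') => ?; case: (lerP a _) => ?;
  case: (lerP a' _) => ?; lra.
Qed.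

End Clip.

Section Nonexpansive.
Variable d : nat.
Implicit Types (f g : pt d -> R) (x y : pt d).

Definition nonexpansive f : Prop := forall x y, `|f x - f y| <= enorm (x - y).

Lemma nonexpansive_le f x y : nonexpansive f -> f x <= f y + enorm (x - y).
Proof. by move=> fne; rewrite -lerBlDl (le_trans (ler_norm _)). Qed.

Lemma nonexpansive_Lip1 f : nonexpansive f -> Lip1 d f.
Proof. by move=> fne x y _ _; exact: fne. Qed.

Definition clamp x : pt d := \row_i clip 0 1 (x ord0 i).

Lemma clamp_cube x : cube d (clamp x).
Proof. by move=> i; rewrite mxE clip_itv. Qed.

Lemma clamp_id x : cube d x -> clamp x = x.
Proof. by move=> xcube; apply/rowP => i; rewrite mxE clip_id. Qed.

Lemma enorm_clamp x y : enorm (clamp x - clamp y) <= enorm (x - y).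
Proof.
by apply: le_enorm => i; rewrite !mxE; apply: ler_dist_clip; rewrite ?subrr ?normr0.
Qed.

Lemma nonexpansive_clamp f : Lip1 d f -> nonexpansive (f \o clamp).
Proof.
by move=> fL x y; apply: le_trans (enorm_clamp x y); apply: fL; exact: clamp_cube.
Qed.

Definition affine (c : R) x (e : pt d) y : R := c + dotp e (y - x).

Lemma affineB c x (e : pt d) y z : affine c x e y - affine c x e z = dotp e (y - z).
Proof. by rewrite /affine opprD addrACA subrr add0r -dotpBr opprB addrA subrK. Qed.

Lemma nonexpansive_affine c x (e : pt d) : enorm e = 1 -> nonexpansive (affine c x e).
Proof. by move=> e1 y z; rewrite affineB normr_dotp_unit. Qed.

Definition clip_around (a : R) f g x : R := clip (f x - a) (f x + a) (g x).

Lemma Lip1_clip_around a f g : Lip1 d f -> Lip1 d g -> Lip1 d (clip_around a f g).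
Proof.
move=> fL gL x y xcube ycube.
by apply: ler_dist_clip; rewrite ?gL // opprD addrACA ?(opprK, subrr) ?addr0 ?fL // addrC fL.
Qed.

Lemma clip_around_center a f g x : 0 <= a -> `|f x - clip_around a f g x| <= a.
Proof.
move=> a0; have := @clip_itv _ (f x - a) (f x + a) (g x).
by rewrite -/(clip_around a f g x) ler_norml; lra.
Qed.

Lemma clip_around_nearer a f g x : 0 <= a -> `|clip_around a f g x - g x| <= `|f x - g x|.
Proof. by move=> a0; apply: clip_nearest; lra. Qed.

Lemma clip_around_id a f g x : `|f x - g x| <= a -> clip_around a f g x = g x.
Proof. by rewrite ler_norml => fg; apply: clip_id; lra. Qed.

End Nonexpansive.

(** * Points of almost maximal growth *)

Lemma leq_sum_itv (F : nat -> nat) (m n N : nat) : (m <= n <= N)%N ->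
  (\sum_(m <= i < n) F i <= \sum_(0 <= i < N) F i)%N.
Proof.
move=> /andP[mn nN]; rewrite (big_cat_nat (n := m) (leq0n m)) ?(leq_trans mn) //=.
by rewrite (big_cat_nat mn nN) addnCA leq_addr.
Qed.

Section RisingSun.
Variables (T : realFieldType) (N : nat) (lam : T).
Hypothesis lam_gt0 : 0 < lam.
Implicit Types (w : nat -> T) (bad : pred nat) (i j m n : nat).

Lemma rising_sun_right w bad m :
  (forall i j, (i <= j <= N)%N -> w i <= w j) ->
  (forall i, (i <= N)%N -> bad i ->
     exists2 j, (i < j <= N)%N & lam * (j%:R - i%:R) < w j - w i) ->
  (m <= N)%N -> lam * (\sum_(m <= i < N.+1) bad i)%:R <= w N - w m.
Proof.
move=> w_homo badP; move: {2}(N.+1 - m)%N (leqnn (N.+1 - m)) => k.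
elim: k m => [|k IH] m Nmk mN; first lia.
have [/(badP _ mN)[j /andP[mj jN] wj]|/negbTE good] := boolP (bad m).
  rewrite (@big_cat_nat _ _ _ j) ?(ltnW mj) ?leqW // natrD mulrDr.
  have : lam * (\sum_(m <= i < j) bad i)%:R <= lam * (j%:R - m%:R).
    rewrite ler_pM2l // -natrB ?(ltnW mj) // ler_nat -[leqRHS]muln1 -sum_nat_const_nat.
    by apply: leq_sum => i _; exact: leq_b1.
  have : lam * (\sum_(j <= i < N.+1) bad i)%:R <= w N - w j by apply: IH; lia.
  lra.
rewrite big_ltn ?ltnS // good add0n.
have [->|ltmN] := eqVneq m N; first by rewrite big_geq // mulr0 subrr.
have {}ltmN : (m < N)%N by rewrite ltn_neqAle ltmN.
have := w_homo m m.+1; rewrite leqnSn ltmN => /(_ isT).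
have : lam * (\sum_(m.+1 <= i < N.+1) bad i)%:R <= w N - w m.+1 by apply: IH; lia.
lra.
Qed.

Lemma rising_sun_left w bad :
  (forall i j, (i <= j <= N)%N -> w i <= w j) ->
  (forall i, (i <= N)%N -> bad i ->
     exists2 j, (j < i)%N & lam * (i%:R - j%:R) < w i - w j) ->
  lam * (\sum_(0 <= i < N.+1) bad i)%:R <= w N - w 0%N.
Proof.
move=> w_homo badP; rewrite big_nat_rev /=.
rewrite (_ : w N - w 0%N = - w (N - N)%N - - w (N - 0)%N); last first.
  by rewrite subnn subn0 opprK addrC.
apply: (rising_sun_right (w := fun i => - w (N - i)%N) (bad := fun i => bad (N - i)%N)) => //.
  by move=> i j ijN; rewrite lerN2 w_homo //; lia.
move=> i iN /(badP _ (leq_subr _ _))[j ji wj]; exists (N - j)%N; first lia.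
have jN : (j <= N)%N by lia.
by move: wj; rewrite subKn // !natrB //; lra.
Qed.

Lemma slow_growth_index w (avoid : pred nat) m n :
  (forall i j, (i <= j <= N)%N -> w i <= w j) -> (m <= n <= N.+1)%N ->
  2 * (w N - w 0%N) + lam * (\sum_(m <= i < n) avoid i)%:R < lam * (n - m)%:R ->
  exists i, [/\ (m <= i < n)%N, ~~ avoid i &
    forall j, (j <= N)%N -> `|w j - w i| <= lam * `|j%:R - i%:R|].
Proof.
move=> w_homo /andP[mn nN] few.
pose right_bad i := `[< exists2 j, (i < j <= N)%N & lam * (j%:R - i%:R) < w j - w i >].
pose left_bad i := `[< exists2 j, (j < i)%N & lam * (i%:R - j%:R) < w i - w j >].
have right_le := @rising_sun_right w right_bad 0 w_homo (fun i _ => @asboolW _) (leq0n N).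
have left_le := @rising_sun_left w left_bad w_homo (fun i _ => @asboolW _).
have [[i imn /norP[avoidi /norP[/asboolPn rgood /asboolPn lgood]]]|all_bad] := pselect
    (exists2 i, (m <= i < n)%N & ~~ [|| avoid i, right_bad i | left_bad i]).
  exists i; split=> // j jN; have [ij|ji|->] := ltngtP i j; last by rewrite !subrr normr0 mulr0.
    rewrite !ger0_norm ?subr_ge0 ?ler_nat ?w_homo ?(ltnW ij) // leNgt.
    by apply/negP => wij; apply: rgood; exists j; rewrite ?ij.
  rewrite !ler0_norm ?subr_le0 ?ler_nat ?w_homo ?(ltnW ji) ?opprB // ?leNgt; last lia.
  by apply/negP => wij; apply: lgood; exists j.
have mnN : (m <= n <= N.+1)%N by rewrite mn.
have : (n - m <= \sum_(m <= i < n) avoid i + \sum_(0 <= i < N.+1) right_bad i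
    + \sum_(0 <= i < N.+1) left_bad i)%N.
  apply: leq_trans (leq_add (leq_add (leqnn _) (leq_sum_itv _ mnN)) (leq_sum_itv _ mnN)).
  rewrite -!big_split /= -[leqLHS]muln1 -sum_nat_const_nat !big_nat.
  apply: leq_sum => i imn; case: (boolP [|| avoid i, right_bad i | left_bad i]).
    by case: (avoid i) (right_bad i) (left_bad i) => -[] [].
  by move=> good; case: all_bad; exists i.
rewrite -(ler_nat T) 2!natrD -(ler_pM2l lam_gt0); lra.
Qed.

End RisingSun.

Definition missed_cell (T : realFieldType) (K : set T) (a h : T) (i : nat) : bool :=
  K `&` `[a + i%:R * h, a + i.+1%:R * h]%classic == set0.

(* A combinatorial substitute for [(1 - kap) (b - a) <= mu (K `&` `[a, b])], in the form needed by
   the discrete rising sun argument. *)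
Definition cell_dense (T : realFieldType) (K : set T) (a b kap : T) : Prop :=
  forall N, (0 < N)%N ->
    (\sum_(0 <= i < N) missed_cell K a ((b - a) / N%:R) i)%:R <= kap * N%:R.

Section CurveFragment.
Variable d : nat.
Implicit Types (f : pt d -> R) (e x y : pt d) (gam : R -> pt d) (K : set R).

Record curve_fragment gam K e (l L eps kap : R) : Prop := CurveFragment {
  fragment_length : 0 < l;
  fragment_times : K `<=` `[0, l]%classic;
  fragment_ends : K 0 /\ K l;
  fragment_tangent : forall t s, K t -> 0 <= s <= l ->
    enorm (gam s - gam t - (s - t) *: e) <= eps * `|s - t|;
  fragment_lipschitz_ge0 : 0 <= L;
  fragment_lipschitz : forall t s, 0 <= t <= l -> 0 <= s <= l ->
    enorm (gam s - gam t) <= L * `|s - t|;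
  fragment_dense : cell_dense K 0 l kap }.

Definition steep_at f x e (c xi r0 : R) : Prop := forall r, `|r| <= r0 ->
  `|f (x + r *: e) - f x - r| <= c * `|r| + xi.

Definition almost_affine f x e (c r1 r2 : R) : Prop :=
  forall y, cube d y -> r1 <= enorm (y - x) <= r2 ->
    `|f y - f x - dotp e (y - x)| <= c * enorm (y - x).

Lemma enorm_shift_le e y (r : R) : enorm e = 1 -> 0 < r ->
  enorm (y + r *: e) <= r + dotp e y + enorm y ^+ 2 / (2 * r).
Proof.
move=> e1 r0; set q := _ / _.
have qE : q * (2 * r) = enorm y ^+ 2 by rewrite mulfVK // mulf_neq0 ?pnatr_eq0 // gt_eqF.
have dotp_lb : - enorm y <= dotp e y by have := normr_dotp_unit y e1; rewrite ler_norml; lra.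
have rhs_ge0 : 0 <= r + dotp e y + q.
  rewrite -(@pmulr_lge0 _ (2 * r)) ?mulr_gt0 // mulrDl qE.
  have := sqr_ge0 (r - enorm y); have := ler_wpM2l (ltW r0) dotp_lb.
  by have := sqr_ge0 r; rewrite !expr2; lra.
rewrite -(@ler_pXn2r _ 2) ?nnegrE ?enorm_ge0 // sqr_enorm.
rewrite dotpDl !dotpDr !dotpZl !dotpZr -!sqr_enorm e1 (dotpC y e) -qE.
have := sqr_ge0 (dotp e y + q); rewrite !expr2; lra.
Qed.

(* Compare [f y] with the values of [f] at [x - r e] and [x + r e], which are almost as far
   apart as a nonexpansive function allows. *)
Lemma steep_at_affine_error f x y e (c xi r0 r : R) :
  nonexpansive f -> enorm e = 1 -> 0 < r <= r0 -> steep_at f x e c xi r0 ->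
  `|f y - f x - dotp e (y - x)| <= c * r + xi + enorm (y - x) ^+ 2 / (2 * r).
Proof.
move=> fne e1 /andP[r_gt0 rr0] steep.
have steepD : `|f (x + r *: e) - f x - r| <= c * r + xi.
  by have := steep r; rewrite gtr0_norm //; apply.
have steepB : `|f (x - r *: e) - f x + r| <= c * r + xi.
  by have := steep (- r); rewrite normrN gtr0_norm // scaleNr opprK; apply.
have := nonexpansive_le y (x - r *: e) fne; have := nonexpansive_le (x + r *: e) y fne.
rewrite opprB addrA (addrAC y) (addrAC x) => upper lower.
have := enorm_shift_le (y - x) e1 r_gt0; have := enorm_shift_le (x - y) e1 r_gt0.
rewrite -(opprB y) dotpNr enormN opprB; move: steepD steepB; rewrite !ler_norml; lra.
Qed.

Lemma steep_at_almost_affine f x e (c dl rho r0 : R) :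
  nonexpansive f -> enorm e = 1 -> 0 < dl -> 0 < rho -> c <= dl ^+ 2 ->
  steep_at f x e c (dl * rho) r0 -> almost_affine f x e (3 * dl) rho (dl * r0).
Proof.
move=> fne e1 dl0 rho0 cdl steep y _ /andP[rho_y y_r0].
have y0 : 0 < enorm (y - x) by apply: lt_le_trans rho_y.
have r_itv : 0 < enorm (y - x) / dl <= r0 by rewrite divr_gt0 //= ler_pdivrMr // mulrC.
apply: le_trans (steep_at_affine_error y fne e1 r_itv steep) _.
have : c * (enorm (y - x) / dl) <= dl * enorm (y - x).
  have -> : dl * enorm (y - x) = dl ^+ 2 * (enorm (y - x) / dl) by field; rewrite gt_eqF.
  by rewrite ler_wpM2r // ltW //; case/andP: r_itv.
have -> : enorm (y - x) ^+ 2 / (2 * (enorm (y - x) / dl)) = dl * enorm (y - x) / 2.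
  by field; rewrite !gt_eqF.
have : dl * rho <= dl * enorm (y - x) by rewrite ler_pM2l.
have := mulr_gt0 dl0 y0; lra.
Qed.

Section SteepPoint.
Variables (f : pt d -> R) (gam : R -> pt d) (K : set R) (e : pt d).
Variables (l L eps kap th lam : R).
Hypotheses (fne : nonexpansive f) (e1 : enorm e = 1).
Hypothesis frag : curve_fragment gam K e l L eps kap.
Hypothesis growth : (1 - th) * l <= f (gam l) - f (gam 0).
Hypotheses (eps_ge0 : 0 <= eps) (th_ge0 : 0 <= th) (lam_itv : 0 < lam <= 1).
Hypothesis errors_small : 4 * (eps + th + (1 + L) * kap) < lam.

Let l_gt0 : 0 < l := fragment_length frag.
Let L_ge0 : 0 <= L := fragment_lipschitz_ge0 frag.

Let kap_ge0 : 0 <= kap.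
Proof. by have := fragment_dense frag (ltn0Sn 0); rewrite mulr1; apply: le_trans. Qed.

Let Lkap_ge0 : 0 <= L * kap.
Proof. exact: mulr_ge0. Qed.

Let eps_le_lam : eps <= lam.
Proof.
have := errors_small; have := Lkap_ge0; have := kap_ge0; have := eps_ge0; have := th_ge0; lra.
Qed.

Lemma fragment_chord t s : K t -> 0 <= s <= l ->
  `|f (gam s) - f (gam t)| <= (1 + eps) * `|s - t|.
Proof.
move=> Kt sl; apply: le_trans (fne _ _) _.
have := enormD (gam s - gam t - (s - t) *: e) ((s - t) *: e).
by rewrite subrK enormZ_unit //; have := fragment_tangent frag Kt sl; lra.
Qed.

Section Grid.
Variables (n N : nat) (h : R).
Hypotheses (n_gt0 : (0 < n)%N) (N4n : N = (4 * n)%N) (hN : h * N%:R = l).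
Let missed := missed_cell K 0 h.

Let middle : (n <= N - n <= N)%N.
Proof. by rewrite leq_subr andbT leq_subRL N4n ?leq_pmull // addnn -mul2n leq_mul2r orbT. Qed.

Let N_gt0 : (0 < N)%N.
Proof. by rewrite N4n muln_gt0. Qed.

Let h_gt0 : 0 < h.
Proof. by rewrite -(@pmulr_lgt0 _ N%:R) ?hN ?l_gt0 ?ltr0n. Qed.

Let hn : h * n%:R = l / 4.
Proof. by rewrite -hN N4n natrM; field. Qed.

Let p (i : nat) : R := i%:R * h.

Let pS i : p i.+1 = p i + h.
Proof. by rewrite /p -(natr1 i) mulrDl mul1r. Qed.

Let p_itv i : (i <= N)%N -> 0 <= p i <= l.
Proof.
move=> iN; rewrite mulr_ge0 ?(ltW h_gt0) //=.
by rewrite -[leRHS]hN [leRHS]mulrC ler_pM2r // ler_nat.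
Qed.

Let missed_cellPn i : ~~ missed i -> exists2 t, K t & p i <= t <= p i + h.
Proof.
by move=> /set0P[t [Kt]]; rewrite /= in_itv /= !add0r -/(p i) -/(p i.+1) pS; exists t.
Qed.

Lemma cell_increment i : (i < N)%N ->
  f (gam (p i.+1)) - f (gam (p i)) <= (1 + eps) * h + L * h * (missed i)%:R.
Proof.
move=> iN; have p_i := p_itv (ltnW iN); have p_i1 := p_itv iN.
have [mi|/missed_cellPn[t Kt /andP[it ti]]] := boolP (missed i).
  have := nonexpansive_le (gam (p i.+1)) (gam (p i)) fne.
  have := fragment_lipschitz frag p_i p_i1.
  have : 0 <= (1 + eps) * h by rewrite mulr_ge0 ?addr_ge0 ?(ltW h_gt0).
  by rewrite [p i.+1 - _]addrC pS addKr (gtr0_norm h_gt0) mulr1; lra.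
have := fragment_chord Kt p_i1; have := fragment_chord Kt p_i.
rewrite mulr0 addr0 pS (ger0_norm (_ : 0 <= p i + h - t)) ?subr_ge0 //.
by rewrite [`|p i - t|]ler0_norm ?subr_le0 // !ler_norml; lra.
Qed.

(* The defect of growth: across a missed cell only the crude slope bound [L] is available, and
   the last term pays for it, so that the defect is nondecreasing. *)
Let defect i : R :=
  (1 + eps) * p i - f (gam (p i)) + L * h * (\sum_(0 <= k < i) missed k)%:R.

Let defect_homo i j : (i <= j <= N)%N -> defect i <= defect j.
Proof.
elim: j => [|j IH]; first by rewrite leqn0 => /andP[/eqP ->].
move=> /andP[+ jN]; rewrite leq_eqVlt ltnS => /orP[/eqP -> //|ij].
apply: le_trans (IH _) _; first by rewrite ij ltnW.
have := cell_increment jN; rewrite /defect big_nat_recr //= natrD pS; lra.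
Qed.

Let missed_le : (\sum_(0 <= i < N) missed i)%:R <= kap * N%:R.
Proof. by have := fragment_dense frag N_gt0; rewrite subr0 -hN mulfK // pnatr_eq0 -lt0n. Qed.

Let defect_growth : defect N - defect 0 <= (eps + th + L * kap) * l.
Proof.
have p0 : p 0 = 0 by exact: mul0r.
have pN : p N = l by rewrite /p mulrC hN.
rewrite /defect (big_geq (leqnn 0)) p0 pN !mulr0 addr0.
have : L * (h * (\sum_(0 <= k < N) missed k)%:R) <= L * (h * (kap * N%:R)).
  by rewrite !ler_wpM2l ?(ltW h_gt0).
rewrite (mulrCA h) hN; have := growth; lra.
Qed.

Let slow_defect_index : exists i, [/\ (n <= i < N - n)%N, ~~ missed i &
  forall j, (j <= N)%N -> `|defect j - defect i| <= lam * h * `|j%:R - i%:R|].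
Proof.
have /andP[lam0 lam1] := lam_itv.
have /andP[nNn NnN] := middle; have nN := leq_trans nNn NnN.
apply: (slow_growth_index (mulr_gt0 lam0 h_gt0) defect_homo); first by rewrite nNn leqW.
have mid_le : (\sum_(n <= i < N - n) missed i)%:R <= kap * N%:R.
  by apply: le_trans missed_le; rewrite ler_nat leq_sum_itv.
have : lam * (h * (\sum_(n <= i < N - n) missed i)%:R) <= lam * (h * (kap * N%:R)).
  by rewrite !ler_wpM2l // ltW.
rewrite (mulrCA h) hN !natrB //.
have : lam * (h * N%:R - h * n%:R - h * n%:R) = lam / 2 * l by rewrite hN hn; field.
have lam_kap := ler_wpM2r kap_ge0 lam1.
have := defect_growth; have : (2 * (eps + th + L * kap) + lam * kap) * l < lam / 2 * l.
  by rewrite ltr_pM2r //; have := errors_small; have := kap_ge0; lra.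
lra.
Qed.

Let slow_defect_steep i j : (i <= j)%N -> defect j - defect i <= lam * (p j - p i) ->
  (1 - lam) * (p j - p i) <= f (gam (p j)) - f (gam (p i)).
Proof.
move=> ij; have : p i <= p j by rewrite ler_pM2r // ler_nat.
rewrite -subr_ge0 /defect => /(mulr_ge0 eps_ge0).
have : 0 <= L * h * ((\sum_(0 <= k < j) missed k)%:R - (\sum_(0 <= k < i) missed k)%:R).
  by rewrite !mulr_ge0 ?(ltW h_gt0) // subr_ge0 ler_nat leq_sum_itv.
lra.
Qed.

Lemma steep_grid_index : exists i t, [/\ (i < N)%N, l / 4 <= p i <= 3 / 4 * l - h,
  K t, p i <= t <= p i + h & forall j, (j <= N)%N ->
    `|f (gam (p j)) - f (gam (p i)) - (p j - p i)| <= lam * `|p j - p i| + 4 * h].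
Proof.
have [i [/andP[ni in3] /missed_cellPn[t Kt tcell] slow]] := slow_defect_index.
have /andP[nNn NnN] := middle; have nN := leq_trans nNn NnN.
have iN : (i < N)%N by apply: leq_trans in3 NnN.
have ni' : n%:R * h <= p i by rewrite ler_pM2r // ler_nat.
have in3' : p i.+1 <= (N - n)%:R * h by rewrite ler_pM2r // ler_nat.
exists i, t; split=> //.
  by move: in3'; rewrite pS natrB //; have := hn; have := hN; lra.
move=> j jN.
have slow_j : `|defect j - defect i| <= lam * `|p j - p i|.
  by rewrite -mulrBl normrM (gtr0_norm h_gt0) mulrCA mulrC slow.
have chord_ij : `|f (gam (p j)) - f (gam (p i))| <= (1 + lam) * `|p j - p i| + 4 * h.
  have := fragment_chord Kt (p_itv jN); have := fragment_chord Kt (p_itv (ltnW iN)).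
  have := ler_distD (f (gam t)) (f (gam (p j))) (f (gam (p i))).
  rewrite (distrC (f (gam t))); have := ler_distD (p i) (p j) t.
  have : `|p i - t| <= h by rewrite ler_norml; lra.
  have /andP[_ lam1] := lam_itv; have eps1 := le_trans eps_le_lam lam1.
  have := ler_wpM2r (normr_ge0 (p j - p i)) eps_le_lam; have := ler_wpM2r (ltW h_gt0) eps1.
  move: `|p j - t| `|p i - t| `|p j - p i| => a b c eps_h eps_c bh ac fd fb fa.
  have : (1 + eps) * (a + b) <= (1 + eps) * (c + 2 * h) by rewrite ler_wpM2l ?addr_ge0 //; lra.
  lra.
have [ij|/ltnW ji] := leqP i j.
  have pij : p i <= p j by rewrite ler_pM2r // ler_nat.
  have := slow_defect_steep ij; move: slow_j chord_ij.
  by rewrite (ger0_norm (_ : 0 <= p j - p i)) ?subr_ge0 // !ler_norml; lra.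
have pji : p j <= p i by rewrite ler_pM2r // ler_nat.
have := slow_defect_steep ji; move: slow_j chord_ij.
by rewrite (ler0_norm (_ : p j - p i <= 0)) ?subr_le0 // !ler_norml; lra.
Qed.

End Grid.

Lemma fragment_steep_time xi : 0 < xi -> exists t, [/\ K t, l / 4 <= t <= 3 / 4 * l &
  forall s, 0 <= s <= l -> `|f (gam s) - f (gam t) - (s - t)| <= lam * `|s - t| + xi].
Proof.
move=> xi0; pose n := (Num.truncn ((8 + 2 * L) * l / xi)).+1; pose N := (4 * n)%N.
have N_gt0 : 0 < N%:R :> R by rewrite ltr0n.
pose h := l / N%:R; have hN : h * N%:R = l by rewrite mulfVK ?gt_eqF.
have h0 : 0 < h by rewrite divr_gt0.
have h_small : (8 + 2 * L) * h <= xi.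
  have : (8 + 2 * L) * l / xi < n%:R by exact: truncnS_gt.
  rewrite mulrA !ltr_pdivrMr // ler_pdivrMr // natrM => /ltW/le_trans; apply.
  by rewrite mulrC ler_pM2l // ler_peMl // ler1n.
have [i [t [iN /andP[ip pi] Kt /andP[pt tp] steep]]] :=
  @steep_grid_index n N h isT erefl hN.
exists t; split=> // [|s sl]; first lra.
have /andP[s0 ls] := sl.
have /truncn_itv/andP[] : 0 <= s / h by rewrite divr_ge0 // ltW.
set j := Num.truncn _; rewrite ler_pdivlMr // ltr_pdivrMr // -natr1 => js sj.
have jN : (j <= N)%N by rewrite -(ler_nat R) -(ler_pM2r h0) [leRHS]mulrC hN; lra.
have grid_itv k : (k <= N)%N -> 0 <= k%:R * h <= l.
  by move=> kN; rewrite mulr_ge0 ?(ltW h0) //= -[leRHS]hN [leRHS]mulrC ler_pM2r // ler_nat.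
have gam_near a b : 0 <= a <= l -> 0 <= b <= l -> `|a - b| <= h ->
    `|f (gam a) - f (gam b)| <= L * h.
  move=> al bl ab; apply: le_trans (fne _ _) (le_trans (fragment_lipschitz frag bl al) _).
  by rewrite ler_wpM2l.
have tl : 0 <= t <= l by lra.
have := gam_near _ _ sl (grid_itv j jN); have := gam_near _ _ tl (grid_itv i (ltnW iN)).
have := steep j jN.
have : lam * `|j%:R * h - i%:R * h| <= lam * `|s - t| + h.
  have /andP[lam0 lam1] := lam_itv; have lam_h := ler_wpM2r (ltW h0) lam1.
  have : `|j%:R * h - i%:R * h| <= `|s - t| + h.
    by have := ler_norm (s - t); have := ler_norm (t - s); rewrite (distrC t s) ler_norml; lra.
  by rewrite -(ler_pM2l lam0); lra.
by rewrite !ler_norml; lra.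
Qed.

Lemma fragment_steep_point xi : 0 < xi ->
  exists2 x, (gam @` K) x & steep_at f x e (lam + eps) xi (l / 4).
Proof.
move=> /fragment_steep_time[t [Kt tl steep]]; exists (gam t) => [|r rl]; first by exists t.
have sl : 0 <= t + r <= l by move: rl; rewrite ler_norml; lra.
have := steep _ sl; have := fragment_tangent frag Kt sl; rewrite [t + r]addrC addrK.
have := fne (gam t + r *: e) (gam (r + t)).
rewrite (enorm_distC _ (gam (r + t))) opprD addrA => fr tangent.
have := ler_normD (f (gam t + r *: e) - f (gam (r + t))) (f (gam (r + t)) - f (gam t) - r).
rewrite addrA subrKA mulrDl; lra.
Qed.

Lemma fragment_almost_affine dl rho : 0 < dl -> lam + eps <= dl ^+ 2 -> 0 < rho ->
  exists2 x, (gam @` K) x & almost_affine f x e (3 * dl) rho (dl * (l / 4)).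
Proof.
move=> dl0 small_dl rho0; have [x Kx steep] := fragment_steep_point (mulr_gt0 dl0 rho0).
by exists x => //; exact: steep_at_almost_affine steep.
Qed.

End SteepPoint.
End CurveFragment.

(** * Coverings by closed sets that are null along curves *)

Section NullAlong.
Variable d : nat.
Implicit Types (C D E F : set (pt d)) (gam : R -> pt d) (v w : pt d).

Definition lipschitz_on_unit gam : Prop :=
  exists L : R, forall s t : R, `[0, 1]%classic s -> `[0, 1]%classic t ->
    enorm (gam s - gam t) <= L * `|s - t|.

(* The existence of a derivative in [D] is part of the condition, so that no differentiability
   theorem for Lipschitz curves is needed. *)
Definition null_along D F : Prop := forall gam, lipschitz_on_unit gam ->
  (@lebesgue_measure R).-negligible
    (`[0, 1]%classic `&` [set t | F (gam t) /\ exists2 v, D v & curve_deriv d gam t v]).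

Lemma null_alongS D D' F F' :
  D' `<=` D -> F' `<=` F -> null_along D F -> null_along D' F'.
Proof.
move=> D'D F'F nullF gam gamL; apply: negligibleS (nullF gam gamL).
by move=> t [t01 [Ft [v Dv gv]]]; do 2?split=> //; [exact: F'F|exists v => //; exact: D'D].
Qed.

Lemma null_alongU D D' F : null_along D F -> null_along D' F -> null_along (D `|` D') F.
Proof.
move=> nullD nullD' gam gamL.
apply: negligibleS (negligibleU (nullD gam gamL) (nullD' gam gamL)).
by move=> t [t01 [Ft [v [Dv|Dv] gv]]]; [left|right]; do 2?split=> //; exists v.
Qed.

Lemma null_along_set0r D : null_along D set0.
Proof.
by move=> gam _; apply: negligibleS (@negligible_set0 _ _ _ _) => t [_ [[]]].
Qed.

Lemma null_along_set0l F : null_along set0 F.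
Proof.
by move=> gam _; apply: negligibleS (@negligible_set0 _ _ _ _) => t [_ [_ [v []]]].
Qed.

Definition coverable D E : Prop := exists C : nat -> set (pt d),
  (forall n, eclosed d (C n) /\ null_along D (C n)) /\ E `<=` \bigcup_n C n.

Lemma coverable_closed D F : eclosed d F -> null_along D F -> coverable D F.
Proof. by move=> Fcl Fnull; exists (fun=> F); split=> // x Fx; exists 0%N. Qed.

Lemma coverableS D D' E E' : D' `<=` D -> E' `<=` E -> coverable D E -> coverable D' E'.
Proof.
move=> D'D E'E [C [Cnull EC]]; exists C; split=> [n|]; last exact: subset_trans EC.
by have [Ccl null] := Cnull n; split=> //; exact: null_alongS null.
Qed.

Lemma coverable_set0r D : coverable D set0.
Proof. by apply: coverable_closed; [exact: eclosed0|exact: null_along_set0r]. Qed.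

Lemma coverable_set0l E : coverable set0 E.
Proof.
apply: (@coverableS set0 _ setT) => //; apply: coverable_closed => //.
exact: null_along_set0l.
Qed.

Lemma coverable_bigcup D (E : nat -> set (pt d)) :
  (forall n, coverable D (E n)) -> coverable D (\bigcup_n E n).
Proof.
move=> /choice[C Cnull].
pose dec := decode (0%N, 0%N); exists (fun n => C (dec n).1 (dec n).2); split=> [n|x [n _ Ex]].
  by have [+ _] := Cnull (dec n).1; apply.
have [_ /(_ x Ex)[k _ Ck]] := Cnull n.
by exists (pickle (n, k)) => //; rewrite /dec pickle_decode.
Qed.

Lemma not_coverable_nonempty D E : ~ coverable D E -> E !=set0 /\ D !=set0.
Proof.
by move=> ncov; split; apply/set0P/eqP => eq0; apply: ncov; rewrite eq0;
  [exact: coverable_set0r|exact: coverable_set0l].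
Qed.

(* If closed sets [C k], null along [D], cover [E], then [D] may be discarded on each [C k]. *)
Lemma not_coverableU D D' E : ~ coverable (D `|` D') E ->
  ~ coverable D E \/ exists2 E', E' `<=` E & ~ coverable D' E'.
Proof.
move=> ncov; have [[C [Cnull EC]]|] := pselect (coverable D E); last by left.
right; have [k ncov_k] : exists k, ~ coverable (D `|` D') (E `&` C k).
  apply: contrapT => no_k; apply: ncov.
  have cov k : coverable (D `|` D') (E `&` C k).
    by apply: contrapT => ncov_k; apply: no_k; exists k.
  apply: (coverableS _ _ (coverable_bigcup cov)) => // x Ex.
  by have [k _ Ck] := EC x Ex; exists k.
exists (E `&` C k) => [x []//|[G [Gnull EG]]]; apply: ncov_k.
have [Ccl Cnull_k] := Cnull k.
exists (fun n => C k `&` G n); split=> [n|x Ex]; last first.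
  by have [n _ Gn] := EG x Ex; exists n => //; split=> //; case: Ex.
have [Gcl Gnull_n] := Gnull n; split; first exact: eclosedI.
by apply: null_alongU; [apply: null_alongS Cnull_k|apply: null_alongS Gnull_n] => // x [].
Qed.

Lemma not_coverable_bigcup (I : choiceType) (r : seq I) (D : I -> set (pt d)) E :
  ~ coverable (\bigcup_(i in [set` r]) D i) E ->
  exists i, i \in r /\ exists2 E', E' `<=` E & ~ coverable (D i) E'.
Proof.
rewrite bigcup_seq; elim: r E => [|i r IH] E.
  by rewrite big_nil => /(_ (coverable_set0l E)).
rewrite big_cons => /not_coverableU[ncov|[E' E'E /IH[j [jr [E'' E''E' ncov]]]]].
  by exists i; rewrite mem_head; split=> //; exists E.
by exists j; rewrite in_cons jr orbT; split=> //; exists E'' => //; exact: subset_trans E'E.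
Qed.

Lemma coverable_purely_unrectifiable E : coverable [set v | v != 0] E ->
  exists P, [/\ Fsigma d P, purely_unrectifiable d P & E `<=` P].
Proof.
move=> [C [Cnull EC]]; exists (\bigcup_n C n); split=> //.
  by exists C; split=> // n; case: (Cnull n).
move=> gam [gamL [c c0 gam_deriv]].
have nullC := negligible_bigcup (fun n => (Cnull n).2 gam gamL).
apply: negligibleS (negligibleU gam_deriv nullC) => t [t01 [n _ Cn]].
have [[v [gv cv]]|] := pselect (exists v, curve_deriv d gam t v /\ c <= enorm v); last by left.
right; exists n => //; do 2?split=> //; exists v => //=.
by rewrite -enorm_gt0; exact: lt_le_trans cv.
Qed.

Definition cone (e : pt d) (eps : R) : set (pt d) :=
  [set v | v != 0 /\ enorm (v - enorm v *: e) <= eps * enorm v].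

Lemma cone_axes_dist e e' (eps eps' : R) v :
  cone e eps v -> cone e' eps' v -> enorm (e - e') <= eps + eps'.
Proof.
move=> [v0 ve] [_ ve']; rewrite -enorm_gt0 in v0.
rewrite -(ler_pM2l v0) -{1}(gtr0_norm v0) -enormZ scalerBr.
have := enorm_distD v (enorm v *: e) (enorm v *: e').
by rewrite (enorm_distC _ v); lra.
Qed.

Lemma cone_normalize w v (eps : R) : w != 0 -> v != 0 ->
  enorm ((enorm v)^-1 *: v - (enorm w)^-1 *: w) <= eps -> cone ((enorm w)^-1 *: w) eps v.
Proof.
move=> w0 v0 vw; split=> //; have ev0 : 0 < enorm v by rewrite enorm_gt0.
rewrite -[v in v - _](scalerKV (lt0r_neq0 ev0)) -scalerBr enormZ (gtr0_norm ev0) mulrC.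
by rewrite ler_pM2r.
Qed.

Lemma not_coverable_cone D E (eps : R) : 0 < eps -> (forall v, D v -> v != 0) ->
  ~ coverable D E ->
  exists D' E' e, [/\ D' `<=` D, E' `<=` E, enorm e = 1, D' `<=` cone e eps & ~ coverable D' E'].
Proof.
move=> eps0 Dneq0 ncov; have eps2 : 0 < eps / 2 by rewrite divr_gt0.
have [net netP] := @ball_finite_net d 1 _ eps2.
pose P y : set (pt d) := [set v | D v /\ enorm ((enorm v)^-1 *: v - y) <= eps / 2].
have [|y [_ [E' E'E ncov']]] := @not_coverable_bigcup _ net P E.
  move=> cov; apply: ncov; apply: (coverableS _ _ cov) => // v Dv.
  have [|y ynet vy] := netP ((enorm v)^-1 *: v); last by exists y.
  by rewrite enorm_normalize ?Dneq0.
have [_ [w [Dw wy]]] := not_coverable_nonempty ncov'; have w0 := Dneq0 w Dw.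
exists (P y), E', ((enorm w)^-1 *: w); split=> //; [by move=> v []| |].
  exact: enorm_normalize.
move=> v [Dv vy]; apply: cone_normalize => //; first exact: Dneq0.
have := enorm_distD y ((enorm v)^-1 *: v) ((enorm w)^-1 *: w).
by rewrite (enorm_distC y); lra.
Qed.

End NullAlong.

Section SigmaIdealKernel.
Variable I : set (set (nat -> nat)).
Hypothesis I_set0 : I set0.
Hypothesis I_sub : forall S S', S' `<=` S -> I S -> I S'.
Hypothesis I_bigcup : forall S : nat -> set (nat -> nat),
  (forall n, I (S n)) -> I (\bigcup_n S n).
Implicit Types (S : set (nat -> nat)) (s t : nat -> nat).

Definition cylinder s (n : nat) : set (nat -> nat) :=
  [set t | forall k, (k < n)%N -> t k = s k].

Definition ideal_kernel S : set (nat -> nat) :=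
  [set s | S s /\ forall n, ~ I (S `&` cylinder s n)].

Lemma ideal_kernel_compl S : I (S `\` ideal_kernel S).
Proof.
pose piece (p : seq nat) := S `&` cylinder (nth 0%N p) (size p).
pose small_piece n := let p := decode [::] n in
  if `[< I (piece p) >] then piece p else set0.
apply: (@I_sub (\bigcup_n small_piece n)); last first.
  by apply: I_bigcup => n; rewrite /small_piece /=; case: asboolP.
move=> s [Ss not_ker]; have [n In] : exists n, I (S `&` cylinder s n).
  by apply: contrapT => no; apply: not_ker; split=> // n In; apply: no; exists n.
have pieceE : piece (mkseq s n) = S `&` cylinder s n.
  rewrite /piece size_mkseq; congr (_ `&` _); apply/seteqP.
  by split=> t ts k kn; have := ts k kn; rewrite nth_mkseq.
exists (pickle (mkseq s n)) => //; rewrite /small_piece pickle_decode pieceE.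
by case: asboolP.
Qed.

Lemma not_ideal_kernel S T : ~ I (S `&` T) -> ~ I (ideal_kernel S `&` T).
Proof.
move=> notI IT; apply: notI.
apply: (@I_sub ((ideal_kernel S `&` T) `|` (S `\` ideal_kernel S))).
  by move=> s [Ss Ts]; have [ks|nks] := pselect (ideal_kernel S s); [left|right].
rewrite -bigcup2E; apply: I_bigcup => -[//|[|n]]; last exact: I_set0.
exact: ideal_kernel_compl.
Qed.

Definition ideal_perfect S : Prop :=
  S !=set0 /\ forall s n, S s -> ~ I (S `&` cylinder s n).

Lemma ideal_perfect_kernel S : ~ I S -> ideal_perfect (ideal_kernel S).
Proof.
move=> notI; split=> [|s n [_ /(_ n)]]; last exact: not_ideal_kernel.
apply/set0P/eqP => ker0; have := @not_ideal_kernel S setT.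
by rewrite ker0 set0I setIT => /(_ notI).
Qed.

End SigmaIdealKernel.

(** * Dense curve fragments through closed sets that are not null *)

Section DensityPoints.
Variables (T : realType) (G : set T).
Local Notation mu := (@lebesgue_measure T).

Lemma density_ball (kap r0 : T) : measurable G -> ~ mu.-negligible G -> 0 < kap -> 0 < r0 ->
  exists t r, [/\ G t, 0 < r < r0 & (((1 - kap) * (r *+ 2))%:E <= mu (G `&` ball t r))%E].
Proof.
move=> mG Gnn kap0 r00.
have [t [Gt dens]] : exists t, G t /\
    (mu (G `&` ball t r) / mu (ball t r))%E @[r --> 0^'+] --> (1 : T)%:E.
  apply: contrapT => no; apply: Gnn; apply: negligibleS (lebesgue_density mG) => t Gt /= ct.
  by apply: no; exists t; split=> //; move: ct; rewrite indicE mem_set.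
have lt1 : ((1 - kap)%:E < 1%:E :> \bar T)%E by rewrite lte_fin; lra.
have [r [[r_gt0 rr0]]] := filter_ex
  (filterI (filterI (nbhs_right_gt (0 : T)) (nbhs_right_lt r00)) (dens _ (open_ereal_gt' lt1))).
have r2 : 0 < r *+ 2 by rewrite mulrn_wgt0.
rewrite /= lebesgue_measure_ball ?(ltW r_gt0) // inver gt_eqF // lte_pdivlMr // -EFinM.
by move=> /ltW dense_r; exists t, r; rewrite r_gt0.
Qed.

Lemma density_itv (kap dl : T) : closed G -> ~ mu.-negligible G -> 0 < kap < 1 -> 0 < dl ->
  exists a b, [/\ G a, G b, a < b, b - a < dl &
    (((1 - kap) * (b - a))%:E <= mu (G `&` `[a, b]%classic))%E].
Proof.
move=> Gcl Gnn /andP[kap0 kap1] dl0; have mG : measurable G by exact: closed_measurable.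
have dl2 : 0 < dl / 2 by rewrite divr_gt0.
have [t [r [Gt /andP[r0 rdl] dense_r]]] := density_ball mG Gnn kap0 dl2.
pose H := G `&` `[t - r, t + r]%classic.
have Hcomp : compact H by rewrite /H setIC; apply: compact_closedI => //; exact: segment_compact.
have H0 : H !=set0 by exists t; split=> //=; rewrite in_itv /=; lra.
have id_cont : {within H, continuous (@id T)} by apply: continuous_subspaceT => x; exact: cvg_id.
have [a /set_mem[Ga at_] a_min] := compact_EVT_min H0 Hcomp id_cont.
have [b /set_mem[Gb bt] b_max] := compact_EVT_max H0 Hcomp id_cont.
have ball_ab : G `&` ball t r `<=` G `&` `[a, b]%classic.
  move=> s [Gs /ltW]; rewrite ler_distlC => ts; split=> //.
  have Hs : s \in H by apply/mem_set; split=> //; rewrite /= in_itv.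
  by rewrite /= in_itv /= a_min ?b_max.
have mball : measurable (G `&` ball t r) by apply: measurableI => //; exact: measurable_ball.
have mitv : measurable (G `&` `[a, b]%classic) by exact: measurableI.
have dense_ab : (((1 - kap) * (r *+ 2))%:E <= mu (G `&` `[a, b]%classic))%E.
  by apply: le_trans dense_r _; apply: le_measure; rewrite ?inE.
move: at_ bt; rewrite /= !in_itv /= => /andP[ta _] /andP[_ bt].
have ba2r : b - a <= r *+ 2 by rewrite mulr2n; lra.
exists a, b; split=> //; last 2 first.
- by apply: le_lt_trans ba2r _; rewrite mulr2n; lra.
- by apply: le_trans dense_ab; rewrite lee_fin ler_wpM2l //; lra.
rewrite ltNge; apply/negP => ba.
have : (mu (G `&` `[a, b]%classic) <= mu `[a, b]%classic)%E by apply: le_measure; rewrite ?inE.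
move=> /(le_trans dense_ab); rewrite lebesgue_measure_itv /= lte_fin ltNge ba /= lee_fin.
by rewrite leNgt mulr_gt0 ?mulrn_wgt0 // subr_gt0.
Qed.

Lemma itv_cell (a h s : T) (N : nat) : (0 < N)%N -> a <= s <= a + N%:R * h ->
  exists2 i, (i < N)%N & a + i%:R * h <= s <= a + i.+1%:R * h.
Proof.
case: N => // N _; elim: N => [|N IH] /andP[as_ sN].
  by exists 0%N => //; rewrite mul0r addr0 as_.
have [sN'|Ns] := leP s (a + N.+1%:R * h); last by exists N.+1 => //; rewrite sN (ltW Ns).
by have [|i iN si] := IH; [rewrite as_|exists i => //; exact: ltnW].
Qed.

Lemma dense_itv_cell_dense (a b kap : T) : measurable G -> a < b ->
  (((1 - kap) * (b - a))%:E <= mu (G `&` `[a, b]%classic))%E ->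
  cell_dense G a b kap.
Proof.
move=> mG ab dense N N0; set h := (b - a) / N%:R; set missed := missed_cell G a h.
have NR : 0 < N%:R :> T by rewrite ltr0n.
have hN : N%:R * h = b - a by rewrite mulrC mulfVK ?gt_eqF.
have h0 : 0 < h by rewrite divr_gt0 // subr_gt0.
pose cell i : set T := if missed i then set0 else `[a + i%:R * h, a + i.+1%:R * h]%classic.
have mcell i : measurable (cell i) by rewrite /cell; case: ifP.
have mu_cell i : mu (cell i) = (h * (1 - (missed i)%:R))%:E.
  rewrite /cell; case: ifP => _; first by rewrite measure0 subrr mulr0.
  rewrite subr0 mulr1 lebesgue_measure_itv /= lte_fin ltrD2l ltr_pM2r // ltr_nat ltnSn.
  by rewrite -EFinB -natr1; congr EFin; ring.
have cover : G `&` `[a, b]%classic `<=` \big[setU/set0]_(i < N) cell i.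
  move=> s [Gs]; rewrite /= in_itv /= => abs.
  have [|i iN si] := @itv_cell a h s N N0; first by rewrite hN addrC subrK.
  rewrite -bigcup_mkord; exists i => //; rewrite /cell ifF /= ?in_itv //.
  by apply/negbTE/set0P; exists s; split=> //=; rewrite in_itv.
have mGab : measurable (G `&` `[a, b]%classic) by exact: measurableI.
have := content_subadditive mu (fun i _ => mcell i) mGab cover.
move=> /(le_trans dense).
rewrite (eq_bigr (fun i : 'I_N => (h * (1 - (missed i)%:R))%:E) (fun i _ => mu_cell i)).
rewrite sumEFin lee_fin -mulr_sumr sumrB sumr_const card_ord -natr_sum -hN big_mkord.
by rewrite mulrA ![_ * h]mulrC ler_pM2l //; lra.
Qed.

Lemma missed_cell_rescale (a h q : T) (i : nat) : 0 < q ->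
  missed_cell [set t | G (a + t / q)] 0 (q * h) i = missed_cell G a h i.
Proof.
move=> q0; have qV0 : 0 < q^-1 by rewrite invr_gt0.
rewrite /missed_cell; apply: negb_inj; apply/idP/idP => /set0P[t [Gt]];
  rewrite /= in_itv /= ?add0r => it; apply/set0P.
  exists (a + t / q); split=> //=; rewrite in_itv /= !lerD2l.
  by rewrite ler_pdivlMr // ler_pdivrMr //; lra.
exists ((t - a) * q); split; first by rewrite /= mulfK ?gt_eqF // addrC subrK.
rewrite /= in_itv /= ![_ * (q * h)]mulrCA ![q * (_ * h)]mulrC !ler_pM2r //.
by rewrite lerBrDl lerBlDl.
Qed.

Lemma cell_dense_rescale (a b kap q : T) : 0 < q -> cell_dense G a b kap ->
  cell_dense [set t | G (a + t / q)] 0 (q * (b - a)) kap.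
Proof.
move=> q0 dense N N0; rewrite subr0 -mulrA.
by under eq_bigr do rewrite missed_cell_rescale //; exact: dense.
Qed.

End DensityPoints.

Section FragmentExistence.
Variable d : nat.
Implicit Types (D F : set (pt d)) (e v : pt d) (gam : R -> pt d) (q del eps : R).

Lemma curve_deriv_secant gam (t : R) v e eps :
  0 < eps -> enorm e = 1 -> cone e eps v -> curve_deriv d gam t v ->
  exists (k : nat) (q : rat), 0 < ratr q :> R /\ forall s, `|s - t| < k.+1%:R^-1 ->
    enorm (gam s - gam t - ((s - t) * ratr q) *: e) <= 2 * eps * ratr q * `|s - t|.
Proof.
move=> eps0 e1 [v0 ve] gv; rewrite -enorm_gt0 in v0.
have slack : 0 < eps / 2 * enorm v by rewrite mulr_gt0 // divr_gt0.
have [del del0 secant] := gv _ slack.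
have [q] : exists q : rat, ratr q \in `]enorm v, enorm v + eps / 2 * enorm v[.
  by apply: rat_in_itvoo; rewrite ltrDl.
rewrite in_itv /= => /andP[vq qv].
exists (Num.truncn del^-1), q; split=> [|s st]; first exact: lt_trans vq.
have [->|neq_st] := eqVneq s t.
  by rewrite !subrr mul0r scale0r subr0 enorm0 normr0 mulr0.
have st0 : 0 < `|s - t| by rewrite normr_gt0 subr_eq0.
have st_del : 0 < `|s - t| < del.
  rewrite st0 (lt_le_trans st) // -[leRHS]invrK lef_pV2 ?posrE ?invr_gt0 ?ltr0n //.
  by apply: ltW; exact: truncnS_gt.
have := secant _ st_del; rewrite (addrC t) subrK; set r := s - t => der.
have -> : gam s - gam t - (r * ratr q) *: e =
    r *: ((r^-1 *: (gam s - gam t) - v) + (v - enorm v *: e) + ((enorm v - ratr q) *: e)).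
  by apply/rowP => i; rewrite !mxE; field; rewrite subr_eq0.
rewrite enormZ mulrC ler_pM2r //.
apply: le_trans (enormD _ _) _; rewrite enormZ_unit //.
have := enormD (r^-1 *: (gam s - gam t) - v) (v - enorm v *: e).
have -> : `|enorm v - ratr q| = ratr q - enorm v by rewrite distrC gtr0_norm ?subr_gt0.
have : eps * enorm v <= eps * ratr q by rewrite ler_pM2l // ltW.
lra.
Qed.

Definition tangent_times gam F e eps q del : set R :=
  [set t | [/\ 0 <= t <= 1, F (gam t) & forall s, 0 <= s <= 1 -> `|s - t| < del ->
    enorm (gam s - gam t - ((s - t) * q) *: e) <= eps * q * `|s - t|]].

Lemma tangent_times_closed gam F e eps q del (L : R) :
  eclosed d F -> enorm e = 1 -> 0 <= eps -> 0 <= q ->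
  (forall s t, 0 <= s <= 1 -> 0 <= t <= 1 -> enorm (gam s - gam t) <= L * `|s - t|) ->
  closed (tangent_times gam F e eps q del).
Proof.
move=> Fcl e1 eps0 q0 gamL t tcl.
have near_t r : 0 < r -> exists2 u, tangent_times gam F e eps q del u & `|t - u| < r.
  by move=> r0; have [u [Gu tu]] := tcl _ (nbhsx_ballx t r r0); exists u.
have t01 : 0 <= t <= 1.
  by apply/andP; split; rewrite leNgt; apply/negP => lt; rewrite -subr_gt0 in lt;
    have [u [/andP[? ?] _ _]] := near_t _ lt; rewrite ltr_norml => /andP[? ?]; lra.
pose C := `|L| + q + eps * q + 1.
have C0 : 0 < C by rewrite /C; have := mulr_ge0 eps0 q0; have := normr_ge0 L; lra.
have near_tC r : 0 < r -> exists u, [/\ tangent_times gam F e eps q del u,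
    `|t - u| < r, C * `|t - u| < r & enorm (gam t - gam u) <= `|L| * `|t - u|].
  move=> r0; have [|u Gu] := near_t (Num.min r (r / C)); first by rewrite lt_min r0 divr_gt0.
  rewrite lt_min ltr_pdivlMr // mulrC => /andP[tu Ctu]; exists u; split=> //.
  have [u01 _ _] := Gu; apply: le_trans (gamL _ _ t01 u01) _.
  by rewrite ler_wpM2r // ler_norm.
split=> // [|s s01 st].
  apply: Fcl => r /near_tC[u [[_ Fu _] tu Ctu gtu]]; exists (gam u); split=> //.
  by apply: le_lt_trans gtu _; apply: le_lt_trans Ctu; rewrite ler_wpM2r // /C;
    have := mulr_ge0 eps0 q0; lra.
apply/ler_addgt0Pr => r r0.
have [|u [[_ _ tangent_u] tu Ctu gtu]] := near_tC (Num.min r (del - `|s - t|)).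
  by rewrite lt_min r0 subr_gt0.
move: tu Ctu; rewrite !lt_min => /andP[_ tu] /andP[Ctu _].
have su : `|s - u| <= `|s - t| + `|t - u| by exact: ler_distD.
have su_del : `|s - u| < del by lra.
have := tangent_u s s01 su_del.
have -> : gam s - gam t - ((s - t) * q) *: e =
    (gam s - gam u - ((s - u) * q) *: e) - (gam t - gam u) + ((t - u) * q) *: e.
  by apply/rowP => i; rewrite !mxE; ring.
have := enormD (gam s - gam u - ((s - u) * q) *: e - (gam t - gam u)) (((t - u) * q) *: e).
have := enormD (gam s - gam u - ((s - u) * q) *: e) (- (gam t - gam u)).
rewrite enormN enormZ_unit // normrM (ger0_norm q0).
have := ler_wpM2l (mulr_ge0 eps0 q0) su; have := normr_ge0 (t - u).
by move: Ctu; rewrite /C; lra.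
Qed.

Lemma not_null_along_tangent_times D F e eps :
  0 < eps -> enorm e = 1 -> D `<=` cone e eps -> ~ null_along D F ->
  exists gam q del, [/\ lipschitz_on_unit gam, 0 < q, 0 < del &
    ~ (@lebesgue_measure R).-negligible (tangent_times gam F e (2 * eps) q del)].
Proof.
move=> eps0 e1 Dcone not_null; apply: contrapT => all_null; apply: not_null => gam gamL.
pose G (kq : nat * rat) : set R := if 0 < ratr kq.2 :> R
  then tangent_times gam F e (2 * eps) (ratr kq.2) kq.1.+1%:R^-1 else set0.
pose dec := decode (0%N, 0 : rat).
have nullG : (@lebesgue_measure R).-negligible (\bigcup_n G (dec n)).
  apply: negligible_bigcup => n; rewrite /G; case: ifPn => [q0|_]; last exact: negligible_set0.
  apply: contrapT => not_null; apply: all_null; exists gam, (ratr (dec n).2), (dec n).1.+1%:R^-1.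
  by rewrite invr_gt0 ltr0n.
apply: negligibleS nullG => t [t01 [Ft [v Dv gv]]].
have [k [q [q0 secant]]] := curve_deriv_secant eps0 e1 (Dcone v Dv) gv.
exists (pickle (k, q)) => //; rewrite /G /dec pickle_decode /= q0; split=> // s _.
exact: secant.
Qed.

Lemma tangent_times_fragment gam F e eps q del (a b L kap : R) :
  (forall s t, 0 <= s <= 1 -> 0 <= t <= 1 -> enorm (gam s - gam t) <= L * `|s - t|) ->
  0 <= L -> 0 < q -> a < b -> b - a < del ->
  let G := tangent_times gam F e eps q del `&` `[a, b]%classic in
  G a -> G b -> cell_dense G a b kap ->
  curve_fragment (fun t => gam (a + t / q)) [set t | G (a + t / q)] e (q * (b - a)) (L / q) eps kap.
Proof.
move=> gamL L0 q0 ab ba_del G Ga Gb dense; pose time t := a + t / q.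
have [[a01 _ _] _] := Ga; have [[b01 _ _] _] := Gb.
have timeB s t : (time s - time t) * q = s - t by rewrite /time; field; rewrite gt_eqF.
have norm_timeB s t : `|time s - time t| * q = `|s - t|.
  by rewrite -[in LHS](gtr0_norm q0) -normrM timeB.
have time_itv t : (a <= time t <= b) = (0 <= t <= q * (b - a)).
  by rewrite lerDl -lerBrDl ler_pdivlMr // mul0r ler_pdivrMr // [_ * q]mulrC.
have time01 t : 0 <= t <= q * (b - a) -> 0 <= time t <= 1 by rewrite -time_itv; lra.
split.
- by rewrite mulr_gt0 // subr_gt0.
- by move=> t [_]; rewrite /= !in_itv /= time_itv.
- by rewrite /= mul0r addr0 mulrC mulKf ?gt_eqF // addrC subrK.
- move=> t s [[_ _ tangent] t_itv] sl; have := tangent (time s) (time01 s sl).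
  have -> : eps * `|s - t| = eps * q * `|time s - time t| by rewrite -norm_timeB; ring.
  rewrite timeB; apply; apply: le_lt_trans ba_del; rewrite ler_distl.
  by move: sl t_itv; rewrite -time_itv /= in_itv /=; lra.
- by rewrite divr_ge0 // ltW.
- move=> t s tl sl; apply: le_trans (gamL _ _ (time01 s sl) (time01 t tl)) _.
  by rewrite -(norm_timeB s t) mulrCA mulrC mulfVK ?gt_eqF.
- exact: cell_dense_rescale.
Qed.

Lemma not_null_along_fragment D F e eps kap0 :
  eclosed d F -> 0 < eps -> enorm e = 1 -> D `<=` cone e eps -> ~ null_along D F -> 0 < kap0 ->
  exists gam K l L kap,
    [/\ curve_fragment gam K e l L (2 * eps) kap, gam @` K `<=` F & (1 + L) * kap <= kap0].
Proof.
move=> Fcl eps0 e1 Dcone not_null kap00.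
have [gam [q [del [[L0 gamL] q0 del0 Gnn]]]] :=
  not_null_along_tangent_times eps0 e1 Dcone not_null.
have gamL01 s t : 0 <= s <= 1 -> 0 <= t <= 1 -> enorm (gam s - gam t) <= `|L0| * `|s - t|.
  move=> s01 t01; apply: le_trans (gamL s t _ _) _; rewrite /= ?in_itv //.
  by rewrite ler_wpM2r // ler_norm.
have Gcl : closed (tangent_times gam F e (2 * eps) q del).
  by apply: tangent_times_closed gamL01 => //; rewrite ?mulr_ge0 // ltW.
pose L := `|L0| / q; have L_ge0 : 0 <= L by rewrite divr_ge0 // ltW.
pose kap := Num.min (1 / 2) (kap0 / (1 + L)).
have kap_itv : 0 < kap < 1.
  by rewrite lt_min gt_min !divr_gt0 ?ltr_pwDl //= ltr_pdivrMr // mul1r ltr1n.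
have [a [b [Ga Gb ab ba_del dense]]] := density_itv Gcl Gnn kap_itv del0.
have ends : `[a, b]%classic a /\ `[a, b]%classic b by rewrite /= !in_itv /= !lexx ltW.
have mG := closed_measurable Gcl.
pose G := tangent_times gam F e (2 * eps) q del `&` `[a, b]%classic.
exists (fun t => gam (a + t / q)), [set t | G (a + t / q)], (q * (b - a)), L, kap.
split; last first.
- by rewrite mulrC -ler_pdivlMr ?ge_min ?lexx ?orbT // ltr_pwDl.
- by move=> _ [t [[_ Ft _] _] <-]; exact: Ft.
apply: (tangent_times_fragment gamL01 _ q0 ab ba_del) => //.
- by split=> //; exact: ends.1.
- by split=> //; exact: ends.2.
by apply: dense_itv_cell_dense => //; [exact: measurableI|rewrite -setIA setIid].
Qed.

End FragmentExistence.

(** * The Banach-Mazur game on 1-Lipschitz functions *)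

Section BanachMazur.
Variable d : nat.
Implicit Types (f g h : pt d -> R) (r s eta : R) (U V P : set (pt d -> R)).

Lemma supdist_lt_refl f r : 0 < r -> supdist_lt d f f r.
Proof. by move=> r0; exists 0 => // x _; rewrite subrr normr0. Qed.

Lemma supdist_lt_trans g f h r s :
  supdist_lt d f g r -> supdist_lt d g h s -> supdist_lt d f h (r + s).
Proof.
move=> [r' rr fg] [s' ss gh]; exists (r' + s'); first exact: ltrD.
by move=> x xcube; apply: le_trans (ler_distD (g x) _ _) _; apply: lerD; auto.
Qed.

Lemma supdist_ltW f g r s : r <= s -> supdist_lt d f g r -> supdist_lt d f g s.
Proof. by move=> rs [r' rr fg]; exists r' => //; exact: lt_le_trans rs. Qed.

Definition lip_open U : Prop := forall f, Lip1 d f -> U f ->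
  exists2 r, 0 < r & forall g, Lip1 d g -> supdist_lt d f g r -> U g.

Lemma lip_open_ball f r : lip_open [set g | supdist_lt d f g r].
Proof.
move=> g gL [s sr fg]; exists ((r - s) / 2) => [|h hL gh]; first by rewrite divr_gt0 ?subr_gt0.
have fg' : supdist_lt d f g ((r + s) / 2) by exists s => //; lra.
by apply: supdist_ltW (supdist_lt_trans fg' gh); lra.
Qed.

Lemma lip_nowhere_dense_setD U V : lip_open U -> lip_open V ->
  (forall f eta, Lip1 d f -> U f -> 0 < eta ->
     exists g, [/\ Lip1 d g, V g & supdist_lt d f g eta]) ->
  lip_nowhere_dense d (U `\` V).
Proof.
move=> Uopen Vopen Vdense [f [r [r0 fL] ball]]; have r2 : 0 < r / 2 by rewrite divr_gt0.
have [_ /(_ _ r2)[g [gL [Ug _] fg]]] := ball f fL (supdist_lt_refl f r0).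
have [h [hL Vh gh]] := Vdense g _ gL Ug r2.
have fh : supdist_lt d f h r by rewrite [r]splitr; exact: supdist_lt_trans gh.
have [rho rho0 Vball] := Vopen h hL Vh.
have [_ /(_ _ rho0)[k [kL [_ notV] hk]]] := ball h hL fh.
exact/notV/Vball.
Qed.

(* Two 1-Lipschitz functions whose values on a fine net have equal roundings are uniformly
   close, and there are countably many rounding patterns. *)
Lemma Lip1_separable : exists q : nat -> (pt d -> R), (forall n, Lip1 d (q n)) /\
  forall f eta, Lip1 d f -> 0 < eta -> exists n, supdist_lt d f (q n) eta.
Proof.
have /choice[net netP] : forall m, exists net : seq (pt d), forall x, enorm x <= d%:R ->
    exists2 y, y \in net & enorm (x - y) <= m.+1%:R^-1.
  by move=> m; apply: ball_finite_net; rewrite invr_gt0.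
pose pattern m f := [seq Num.floor (f (clamp y) * m.+1%:R) | y <- net m].
pose dec := decode (0%N, [::] : seq int).
have /choice[q qP] : forall n, exists g, Lip1 d g /\
    forall f, Lip1 d f -> pattern (dec n).1 f = (dec n).2 -> pattern (dec n).1 g = (dec n).2.
  move=> n; have [[g [gL gn]]|no] :=
    pselect (exists g, Lip1 d g /\ pattern (dec n).1 g = (dec n).2); first by exists g.
  exists (fun=> 0); split; first by move=> x y _ _; rewrite subrr normr0 enorm_ge0.
  by move=> f fL fn; exfalso; apply: no; exists f.
exists q; split=> [n|f eta fL eta0]; first by case: (qP n).
pose m := Num.truncn (3 / eta); pose n := pickle (m, pattern m f).
have m0 : 0 < m.+1%:R :> R by rewrite ltr0n.
exists n, (3 / m.+1%:R).
  by rewrite ltr_pdivrMr // mulrC -ltr_pdivrMr //; exact: truncnS_gt.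
have [qL] := qP n; rewrite /dec pickle_decode => /(_ f fL erefl) same_pattern x xcube.
have [|y ynet xy] := netP m x.
  rewrite -[d%:R]mulr1; apply: enorm_le_coords => i.
  by have /andP[? ?] := xcube i; rewrite ger0_norm.
have xcy : enorm (x - clamp y) <= m.+1%:R^-1.
  by rewrite -{1}(clamp_id xcube); exact: le_trans (enorm_clamp _ _) xy.
have ycube := clamp_cube y.
have fq_y : `|f (clamp y) - q n (clamp y)| <= m.+1%:R^-1.
  rewrite -[leRHS]mul1r ler_pdivlMr // -{1}(gtr0_norm m0) -normrM mulrBl.
  have floorE : Num.floor (f (clamp y) * m.+1%:R) = Num.floor (q n (clamp y) * m.+1%:R).
    by move/eq_in_map: same_pattern => /(_ y ynet).
  have := real_floor_itv (num_real (f (clamp y) * m.+1%:R)).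
  have := real_floor_itv (num_real (q n (clamp y) * m.+1%:R)).
  by rewrite floorE !intrD ler_norml; lra.
have := fL x (clamp y) xcube ycube; have := qL x (clamp y) xcube ycube.
move: xcy fq_y; rewrite !ler_norml; move: (m.+1%:R^-1) (enorm _) => a b; lra.
Qed.

Section WinningStrategy.
Variables (Z : Type) (moves : Z -> Z -> Prop) (U : Z -> set (pt d -> R)) (z0 : Z).
Variable P : set (pt d -> R).
Hypothesis Uopen : forall z, lip_open (U z).
Hypothesis U0 : forall f, Lip1 d f -> U z0 f.
Hypothesis strategy : forall z f eta, Lip1 d f -> U z f -> 0 < eta -> exists z' f',
  [/\ moves z z', Lip1 d f', U z' f' & supdist_lt d f f' eta].
Hypothesis outcome : forall f (zs : nat -> Z), Lip1 d f -> zs 0%N = z0 ->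
  (forall n, U (zs n) f /\ moves (zs n) (zs n.+1)) -> P f.

(* As [Lip1] is separable, it is enough to answer countably many moves of the first player, so
   that no disjoint families of responses are needed. *)
Lemma countable_responses : exists resp : Z -> nat -> Z,
  forall z f eta, Lip1 d f -> U z f -> 0 < eta -> exists n f',
    [/\ moves z (resp z n), Lip1 d f', U (resp z n) f' & supdist_lt d f f' eta].
Proof.
have [q [qL qdense]] := Lip1_separable.
pose dec := decode (0%N, 0%N).
have /choice[resp respP] : forall zn : Z * nat, exists z',
    U zn.1 (q (dec zn.2).1) -> moves zn.1 z' /\ exists f',
      [/\ Lip1 d f', U z' f' & supdist_lt d (q (dec zn.2).1) f' (dec zn.2).2.+1%:R^-1].
  move=> [z n] /=; have [Uq|] := pselect (U z (q (dec n).1)); last by exists z0.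
  have [|z' [f' [zz' f'L Uf' qf']]] := strategy (eta := (dec n).2.+1%:R^-1) (qL (dec n).1) Uq.
    by rewrite invr_gt0.
  by exists z' => _; split=> //; exists f'.
exists (fun z n => resp (z, n)) => z f eta fL Uf eta0.
have [rho rho0 Uball] := Uopen fL Uf.
have [|k fq] := qdense f (Num.min rho (eta / 2)) fL; first by rewrite lt_min rho0 divr_gt0.
have Uq : U z (q k) by apply: Uball => //; apply: supdist_ltW fq; rewrite ge_min lexx.
pose j := Num.truncn (2 / eta); pose n := pickle (k, j).
have := respP (z, n); rewrite /dec pickle_decode => /(_ Uq)[zz' [f' [f'L Uf' qf']]].
exists n, f'; split=> //; rewrite [eta]splitr; apply: (supdist_lt_trans (g := q k)).
  by apply: supdist_ltW fq; rewrite ge_min lexx orbT.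
apply: supdist_ltW qf'; rewrite -[leRHS]invrK lef_pV2 ?posrE ?invr_gt0 ?divr_gt0 // invf_div.
by apply: ltW; exact: truncnS_gt.
Qed.

Lemma banach_mazur : lip_residual d P.
Proof.
have [resp respP] := countable_responses.
pose pos := foldr (fun n z => resp z n) z0.
pose next l : set (pt d -> R) :=
  [set f | exists2 n, moves (pos l) (pos (n :: l)) & U (pos (n :: l)) f].
exists (fun k => let l := decode [::] k in U (pos l) `\` next l); split=> [k|f fL notP].
  set l := decode _ _; apply: lip_nowhere_dense_setD => // [f fL [n mv Uf]|f eta fL Uf eta0].
    by have [r r0 Uball] := Uopen fL Uf; exists r => // g gL fg; exists n => //; exact: Uball.
  have [n [f' [mv f'L Uf' ff']]] := respP _ _ _ fL Uf eta0.
  by exists f'; split=> //; exists n.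
apply: contrapT => no_stage; apply: notP.
have /choice[nx nxP] : forall l, exists n, U (pos l) f ->
    moves (pos l) (pos (n :: l)) /\ U (pos (n :: l)) f.
  move=> l; have [Ul|] := pselect (U (pos l) f); last by exists 0%N.
  apply: contrapT => no; apply: no_stage; exists (pickle l); rewrite pickle_decode; split=> //.
  by move=> [n mv Un]; apply: no; exists n.
pose run := fix run n := if n is m.+1 then nx (run m) :: run m else [::].
have Urun n : U (pos (run n)) f.
  by elim: n => [|n IH] /=; [exact: U0|have [] := nxP _ IH].
apply: (outcome (zs := fun n => pos (run n)) fL) => // n; split=> //.
by have [] := nxP _ (Urun n).
Qed.

End WinningStrategy.
End BanachMazur.

(** * Differentiability from affine approximation at all scales *)

Lemma cauchy_rate_limit (T : realType) (u a : nat -> T) :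
  (forall m n, (m <= n)%N -> `|u m - u n| <= a m) -> exists l, forall n, `|u n - l| <= a n.
Proof.
move=> ua; have lower_upper m n : u m - a m <= u n + a n.
  have a_ge0 k : 0 <= a k by have := ua k k (leqnn k); rewrite subrr normr0.
  have := a_ge0 m; have := a_ge0 n.
  have [/ua|/ltnW/ua] := leqP m n; rewrite ler_norml; lra.
pose lower := range (fun n => u n - a n).
have lower_ub n : ubound lower (u n + a n) by move=> _ [m _ <-]; exact: lower_upper.
have lower0 : lower !=set0 by exists (u 0%N - a 0%N), 0%N.
exists (sup lower) => n; have : sup lower <= u n + a n by exact: ge_sup.
have : u n - a n <= sup lower by apply: ub_le_sup; [exists (u 0%N + a 0%N)|exists n].
by rewrite ler_norml; lra.
Qed.

Lemma subset_decreasing (T : Type) (S : nat -> set T) :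
  (forall n, S n.+1 `<=` S n) -> {homo S : m n / (m <= n)%N >-> n `<=` m}.
Proof.
move=> S_decr; apply: (homo_leq (r := fun A B => B `<=` A)) => [A|B A C BA CB|//].
  exact: subset_refl.
exact: subset_trans CB BA.
Qed.

Section Limits.
Variable d : nat.
Implicit Types (f : pt d -> R) (x y v : pt d) (g : (nat -> nat) -> pt d).

Lemma open_cube_ball x : open_cube d x ->
  exists2 r : R, 0 < r & forall y, enorm (y - x) < r -> cube d y.
Proof.
move=> xopen.
pose r := \big[Num.min/1]_(i < d) Num.min (x ord0 i) (1 - x ord0 i).
exists r => [|y yx i].
  by apply: lt_bigmin => // i _; have /andP[x0 x1] := xopen i; rewrite lt_min subr_gt0 x0.
have := le_lt_trans (coord_le_enorm (y - x) i) yx; rewrite !mxE ltr_norml => /andP[? ?].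
have : r <= Num.min (x ord0 i) (1 - x ord0 i) by exact: bigmin_le.
by rewrite le_min => /andP[? ?]; apply/andP; split; lra.
Qed.

Lemma cauchy_rate_unit_limit (e : nat -> pt d) (a : nat -> R) :
  (forall m n, (m <= n)%N -> enorm (e m - e n) <= a m) -> a @ \oo --> (0 : R) ->
  (forall n, enorm (e n) = 1) ->
  exists2 v, enorm v = 1 & (fun n => enorm (e n - v)) @ \oo --> (0 : R).
Proof.
move=> e_cauchy a0 e1.
have /choice[v ev] : forall i : 'I_d, exists l, forall n, `|e n ord0 i - l| <= a n.
  move=> i; apply: cauchy_rate_limit => m n /e_cauchy; apply: le_trans.
  by have := coord_le_enorm (e m - e n) i; rewrite !mxE.
set w : pt d := \row_i v i.
have ew n : enorm (e n - w) <= d%:R * a n by apply: enorm_le_coords => i; rewrite !mxE.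
have da0 : (fun n => d%:R * a n) @ \oo --> (0 : R).
  by rewrite -(mulr0 d%:R); apply: cvgM => //; exact: cvg_cst.
exists w.
  apply/eqP; rewrite -subr_eq0 -normr_le0; apply: (cvgr_to_ge da0); apply: nearW => n.
  by rewrite -[X in _ - X](e1 n); apply: le_trans (ler_enorm_dist _ _) _; rewrite enorm_distC.
apply: squeeze_cvgr (cvg_cst _) da0; apply: nearW => n.
by rewrite enorm_ge0 ew.
Qed.

Lemma has_gradient_of_scales f x v (e : nat -> pt d) (c al : nat -> R) :
  open_cube d x -> (forall n, 0 < al n) -> al @ \oo --> (0 : R) ->
  c @ \oo --> (0 : R) -> (fun n => enorm (e n - v)) @ \oo --> (0 : R) ->
  (forall n, almost_affine f x (e n) (c n) (al n.+1) (al n)) -> has_gradient d f x v.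
Proof.
move=> /open_cube_ball[w w0 wcube] al0 al_cvg c_cvg e_cvg affine_f eps eps0.
have eps2 : 0 < eps / 2 by rewrite divr_gt0.
have [N _ err_eps] := filterI (cvgr_lt _ c_cvg _ eps2) (cvgr_lt _ e_cvg _ eps2).
exists (Num.min w (al N)) => [|y]; first by rewrite lt_min w0 al0.
rewrite lt_min => /andP[/wcube ycube y_alN].
have [->|yx] := eqVneq y x; first by rewrite !subrr dotpC dotp0l subrr normr0 enorm0 mulr0.
have yx0 : 0 < enorm (y - x) by rewrite enorm_gt0 subr_eq0.
have scale_ex : exists n, (N <= n)%N && (al n <= enorm (y - x)).
  have [M _ al_small] := cvgr_lt _ al_cvg _ yx0.
  by exists (maxn N M); rewrite leq_maxl ltW // al_small //= leq_maxr.
case: (ex_minnP scale_ex) => -[|n] /andP[Nn al_n] n_min.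
  by move: Nn al_n y_alN; rewrite leqn0 => /eqP ->; lra.
have {}Nn : (N <= n)%N.
  by move: Nn al_n; rewrite leq_eqVlt => /predU1P[<-|//]; lra.
have y_scale : al n.+1 <= enorm (y - x) <= al n.
  rewrite al_n leNgt; apply/negP => /ltW al_n'.
  by have := n_min n; rewrite Nn al_n' => /(_ isT); rewrite ltnn.
have := affine_f n y ycube y_scale; have := normr_dotp (e n - v) (y - x).
have -> : f y - f x - dotp v (y - x) = f y - f x - dotp (e n) (y - x) + dotp (e n - v) (y - x).
  by rewrite dotpBl; ring.
have := ler_normD (f y - f x - dotp (e n) (y - x)) (dotp (e n - v) (y - x)).
have : (c n + enorm (e n - v)) * enorm (y - x) <= eps * enorm (y - x).
  by rewrite ler_pM2r //; have [] := err_eps n Nn; lra.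
lra.
Qed.

Lemma nested_codes_limit g (S : nat -> set (nat -> nat)) :
  baire_continuous d g -> (forall n, S n.+1 `<=` S n) -> (forall n, S n !=set0) ->
  (forall n s t k, S n.+1 s -> S n.+1 t -> (k <= n)%N -> s k = t k) ->
  exists s, forall n, eclosure (g @` S n) (g s).
Proof.
move=> gcont S_decr /choice[tau tauS] S_agree.
have S_le := subset_decreasing S_decr.
pose s k := tau k.+1 k; exists s => n r r0.
have tau_s m k : (k < m)%N -> tau m k = s k.
  by move=> km; apply: (S_agree k _ _ _ (S_le _ _ km _ (tauS m)) (tauS k.+1)).
have [N sN] := gcont s r r0; exists (g (tau (maxn n N))); split.
  by exists (tau (maxn n N)) => //; exact: (S_le _ _ (leq_maxl n N) _ (tauS _)).
rewrite enorm_distC; apply: sN => k kN; apply: tau_s.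
by apply: leq_trans kN _; exact: leq_maxr.
Qed.

End Limits.

(** * The strategy *)

Definition tolerance : nat -> R := harmonic.
Definition aperture (n : nat) : R := (tolerance n.+1 / 16) ^+ 2.

Lemma tolerance_gt0 n : 0 < tolerance n.
Proof. exact: harmonic_gt0. Qed.

Lemma tolerance_le1 n : tolerance n <= 1.
Proof. by rewrite invf_le1 ?ltr0n // ler1n. Qed.

Lemma tolerance_le m n : (m <= n)%N -> tolerance n <= tolerance m.
Proof. by move=> mn; rewrite lef_pV2 ?posrE ?ltr0n // ler_nat. Qed.

Lemma aperture_gt0 n : 0 < aperture n.
Proof. by rewrite exprn_gt0 // divr_gt0 // tolerance_gt0. Qed.

Lemma aperture_le m n : (m <= n)%N -> aperture n <= aperture m.
Proof.
move=> mn; rewrite lerXn2r ?nnegrE ?divr_ge0 ?(ltW (tolerance_gt0 _)) //.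
by rewrite ler_pM2r // tolerance_le.
Qed.

Lemma aperture_le_tolerance n : aperture n <= tolerance n.
Proof.
have := tolerance_le (leqnSn n); have := tolerance_gt0 n.+1; have := tolerance_le1 n.+1.
rewrite /aperture; nra.
Qed.

Lemma cvg_aperture : aperture @ \oo --> (0 : R).
Proof.
apply: (squeeze_cvgr (f := fun=> 0) (h := tolerance)); [|exact: cvg_cst|exact: cvg_harmonic].
by apply: nearW => n; rewrite ltW ?aperture_gt0 ?aperture_le_tolerance.
Qed.

(* [codes] index the remaining points of the analytic set; [velocities] are the remaining
   velocities, all in directions close to [axis]; [scale] is the scale down to which affine
   approximation is already guaranteed. *)
Record position (d : nat) := Position {
  level : nat;
  functions : set (pt d -> R);
  codes : set (nat -> nat);
  velocities : set (pt d);
  axis : pt d;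
  scale : R }.

Section Strategy.
Variables (d : nat) (g : (nat -> nat) -> pt d).
Hypotheses (gcube : forall s, cube d (g s)) (gcont : baire_continuous d g).
Implicit Types (D : set (pt d)) (S : set (nat -> nat)) (f h : pt d -> R) (e x y : pt d).
Implicit Types (z : position d) (n : nat).

Definition coverable_codes D : set (set (nat -> nat)) := [set S | coverable D (g @` S)].

Definition nowhere_coverable D S : Prop := ideal_perfect (coverable_codes D) S.

Lemma nowhere_coverable_kernel D S : ~ coverable D (g @` S) ->
  exists2 S', S' `<=` S & nowhere_coverable D S'.
Proof.
move=> ncov; exists (ideal_kernel (coverable_codes D) S); first by move=> s [].
apply: ideal_perfect_kernel => //; rewrite /coverable_codes /=.
- by rewrite image_set0; exact: coverable_set0r.
- by move=> T T' T'T; apply: coverableS => //; exact: image_subset.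
- by move=> T covT; rewrite image_bigcup; exact: coverable_bigcup.
Qed.

Lemma nowhere_coverableW D S : nowhere_coverable D S -> ~ coverable D (g @` S).
Proof.
by move=> [[s Ss] /(_ s 0%N Ss)]; apply: contra_not; apply: coverableS => //; exact: image_subset.
Qed.

Lemma eclosure_codes_cube S : eclosure (g @` S) `<=` cube d.
Proof. by apply: eclosure_min; [exact: eclosed_cube|move=> _ [s _ <-]]. Qed.

Record valid z : Prop := Valid {
  valid_axis : enorm (axis z) = 1;
  valid_scale : 0 < scale z <= tolerance (level z);
  valid_cone : velocities z `<=` cone (axis z) (aperture (level z));
  valid_codes : nowhere_coverable (velocities z) (codes z);
  valid_open : lip_open (functions z);
  valid_affine : forall f, Lip1 d f -> functions z f -> forall rho : R, 0 < rho ->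
    exists2 x, eclosure (g @` codes z) x &
      almost_affine f x (axis z) (3 * tolerance (level z)) rho (2 * scale z) }.

Record follows z z' : Prop := Follows {
  follows_level : level z' = (level z).+1;
  follows_codes : codes z' `<=` codes z;
  follows_digits : forall s t k, codes z' s -> codes z' t -> (k <= level z)%N -> s k = t k;
  follows_velocities : velocities z' `<=` velocities z;
  follows_affine : forall f x, Lip1 d f -> functions z' f -> eclosure (g @` codes z') x ->
    almost_affine f x (axis z) (8 * tolerance (level z)) (scale z') (scale z) }.

Lemma fragment_affine_growth f gam K e e' c x (l L eps kap a r : R) :
  curve_fragment gam K e' l L eps kap -> enorm e = 1 -> enorm (e - e') <= a ->
  `|f (gam 0) - affine c x e (gam 0)| <= r -> `|f (gam l) - affine c x e (gam l)| <= r ->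
  (1 - a - eps) * l - 2 * r <= f (gam l) - f (gam 0).
Proof.
move=> frag e1 ee' f0 fl; have l0 := fragment_length frag.
have dot_ee' : 1 - a <= dotp e e'.
  have := normr_dotp_unit (e - e') e1.
  by rewrite dotpBr -sqr_enorm e1 expr1n ler_norml; lra.
have l_itv : 0 <= l <= l by rewrite lexx ltW.
have [K0 _] := fragment_ends frag.
have := fragment_tangent frag K0 l_itv; rewrite subr0 (gtr0_norm l0) => tangent.
have := normr_dotp_unit (gam l - gam 0 - l *: e') e1.
rewrite dotpBr dotpZr -(affineB c x).
have : l * (1 - a) <= l * dotp e e' by rewrite ler_pM2l.
by move: f0 fl; rewrite !ler_norml; lra.
Qed.

Lemma near_affine_almost_affine D S n f c x e e' :
  ~ coverable D (g @` S) -> enorm e = 1 -> enorm e' = 1 ->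
  D `<=` cone e (aperture n) -> D `<=` cone e' (aperture n.+1) ->
  (forall y, eclosure (g @` S) y -> f y = affine c x e y) ->
  exists al r : R, [/\ 0 < al, 0 < r & forall h, Lip1 d h -> supdist_lt d f h r ->
    forall rho : R, 0 < rho -> exists2 y, eclosure (g @` S) y &
      almost_affine h y e' (3 * tolerance n.+1) rho al].
Proof.
move=> ncov e1 e'1 De De' f_affine.
have [_ [v Dv]] := not_coverable_nonempty ncov.
have axes := cone_axes_dist (De v Dv) (De' v Dv).
have not_null : ~ null_along D (eclosure (g @` S)).
  move=> null; apply: ncov; apply: (coverableS (D := D) (E := eclosure (g @` S))) => //.
    exact: subset_eclosure.
  by apply: coverable_closed => //; exact: eclosure_closed.
have a0 := aperture_gt0 n; have a'0 := aperture_gt0 n.+1; have a'a := aperture_le (leqnSn n).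
have [gam [K [l [L [kap [frag Kcl kap_small]]]]]] :=
  not_null_along_fragment (@eclosure_closed d (g @` S)) a'0 e'1 De' not_null a'0.
have l0 := fragment_length frag; have [K0 Kl] := fragment_ends frag.
have tol0 := tolerance_gt0 n.+1; have tol1 := tolerance_le1 n.+1.
exists (tolerance n.+1 * (l / 4)), (aperture n.+1 * l / 2).
split; [by rewrite mulr_gt0 // divr_gt0|by rewrite divr_gt0 // mulr_gt0|].
move=> h hL [r rl fh] rho rho0.
have ends t : K t -> `|h (gam t) - affine c x e (gam t)| <= r /\ clamp (gam t) = gam t.
  move=> Kt; have gam_cl : eclosure (g @` S) (gam t) by apply: Kcl; exists t.
  have gam_cube := eclosure_codes_cube gam_cl.
  by rewrite clamp_id // -f_affine // distrC fh.
have [h0 c0] := ends 0 K0; have [hl cl] := ends l Kl.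
have growth := fragment_affine_growth frag e1 axes h0 hl.
pose th := aperture n + 4 * aperture n.+1; pose lam := tolerance n.+1 ^+ 2 / 2.
have h_growth : (1 - th) * l <= (h \o @clamp d) (gam l) - (h \o @clamp d) (gam 0).
  by rewrite /= c0 cl /th; lra.
have apE : aperture n = lam / 128 by rewrite /lam /aperture expr_div_n; field.
have lam_itv : 0 < lam <= 1 by rewrite divr_gt0 ?exprn_gt0 //= ler_pdivrMr // mul1r; nra.
have errors_small : 4 * (2 * aperture n.+1 + th + (1 + L) * kap) < lam by rewrite /th; lra.
have tol_sqr : lam + 2 * aperture n.+1 <= tolerance n.+1 ^+ 2 by rewrite /lam in apE *; lra.
have eps_ge0 : 0 <= 2 * aperture n.+1 by lra.
have th_ge0 : 0 <= th by rewrite /th; lra.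
have [_ [t Kt <-] aff] := fragment_almost_affine (nonexpansive_clamp hL) e'1 frag h_growth
  eps_ge0 th_ge0 lam_itv errors_small tol0 tol_sqr rho0.
exists (gam t) => [|y ycube y_scale]; first by apply: Kcl; exists t.
by have := aff y ycube y_scale; rewrite /= (clamp_id ycube) (ends t Kt).2.
Qed.

Lemma refine_codes D S x (eps r : R) (m : nat) :
  nowhere_coverable D S -> (forall v, D v -> v != 0) -> eclosure (g @` S) x ->
  0 < eps -> 0 < r -> exists D' S' e,
  [/\ D' `<=` D, D' `<=` cone e eps, enorm e = 1 & nowhere_coverable D' S'] /\
  [/\ S' `<=` S, forall s t k, S' s -> S' t -> (k <= m)%N -> s k = t k &
    eclosure (g @` S') `<=` [set y | enorm (y - x) <= r]].
Proof.
move=> [_ Sbig] Dneq0 xS eps0 r0; have r2 : 0 < r / 2 by rewrite divr_gt0.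
have [_ [[s Ss <-] xs]] := xS _ r2; have [m' s_cont] := gcont s r2.
have ncov := Sbig s (maxn m.+1 m') Ss.
have [D' [E [e [D'D E_sub e1 D'cone ncovE]]]] := not_coverable_cone eps0 Dneq0 ncov.
pose T := S `&` cylinder s (maxn m.+1 m') `&` g @^-1` E.
have ET : E `<=` g @` T.
  by move=> y Ey; have [t St gty] := E_sub y Ey; exists t => //; split=> //=; rewrite gty.
have [S' S'T S'big] : exists2 S', S' `<=` T & nowhere_coverable D' S'.
  by apply: nowhere_coverable_kernel; apply: contra_not ncovE; apply: coverableS.
exists D', S', e; do 2?split=> //.
- by move=> t /S'T[[]].
- move=> t u k /S'T[[_ ts] _] /S'T[[_ us] _] km.
  by rewrite ts ?us // leq_max ltnS km.
apply: eclosure_min; first exact: eclosed_ball.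
move=> _ [t /S'T[[_ ts] _] <-]; have : enorm (g t - g s) < r / 2.
  by apply: s_cont => k km; apply: ts; exact: leq_trans km (leq_maxr _ _).
by rewrite /=; have := enorm_distD (g s) (g t) x; rewrite (enorm_distC (g s) x); lra.
Qed.

(* Where [f] is exactly affine around [x], moving the base point from [x] to [x'] costs
   nothing; elsewhere [y] is at least half as far from [x'] as from [x]. *)
Lemma almost_affine_perturb f h e x x' (c a rho al al' r : R) :
  0 <= c -> cube d x' -> 0 < rho <= al -> enorm (x' - x) <= rho / 2 -> r <= c * al' ->
  (forall y, cube d y -> enorm (y - x) <= rho -> f y = affine a x e y) ->
  (forall y, cube d y -> rho <= enorm (y - x) <= 2 * al ->
     `|f y - affine a x e y| <= 3 * c * enorm (y - x)) ->
  (forall y, cube d y -> `|f y - h y| <= r) ->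
  almost_affine h x' e (8 * c) al' al.
Proof.
move=> c0 x'cube /andP[rho0 rho_al] x'x r_small f_eq f_near fh y ycube /andP[al'_y y_al].
have yx := enorm_distD x' y x; have f_x' : f x' = affine a x e x' by apply: f_eq => //; lra.
have f_y : `|f y - affine a x e y| <= 6 * c * enorm (y - x').
  have [/(f_eq y ycube) ->|rho_y] := leP (enorm (y - x)) rho.
    by rewrite subrr normr0 mulr_ge0 ?enorm_ge0 // mulr_ge0.
  have y_itv : rho <= enorm (y - x) <= 2 * al by rewrite (ltW rho_y); lra.
  apply: le_trans (f_near y ycube y_itv) _.
  have : c * enorm (y - x) <= c * (2 * enorm (y - x')) by rewrite ler_wpM2l //; lra.
  lra.
have : c * al' <= c * enorm (y - x') by rewrite ler_wpM2l.
have := fh y ycube; have := fh x' x'cube; move: f_y.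
by rewrite -(affineB a x) f_x' !ler_norml; lra.
Qed.

Lemma affine_modification f x e (c rho r eta : R) :
  Lip1 d f -> cube d x -> enorm e = 1 -> 0 < eta -> 4 * rho <= eta ->
  almost_affine f x e c rho r -> exists f', [/\ Lip1 d f', supdist_lt d f f' eta,
    forall y, cube d y -> enorm (y - x) <= rho -> f' y = affine (f x) x e y &
    forall y, cube d y -> rho <= enorm (y - x) <= r ->
      `|f' y - affine (f x) x e y| <= c * enorm (y - x)].
Proof.
move=> fL xcube e1 eta0 rho_eta fx; have eta2 : 0 <= eta / 2 by rewrite divr_ge0 // ltW.
exists (clip_around (eta / 2) f (affine (f x) x e)); split=> [||y ycube yx|y ycube y_itv].
- by apply: Lip1_clip_around => //; apply: nonexpansive_Lip1; exact: nonexpansive_affine.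
- by exists (eta / 2) => [|y _]; [lra|exact: clip_around_center].
- apply: clip_around_id; rewrite /affine opprD addrA.
  have := fL y x ycube xcube; have := normr_dotp_unit (y - x) e1.
  by have := ler_normB (f y - f x) (dotp e (y - x)); lra.
apply: le_trans (clip_around_nearer _ _ _ eta2) _.
by rewrite /affine opprD addrA; exact: fx.
Qed.

Lemma winning_move z f (eta : R) : valid z -> Lip1 d f -> functions z f -> 0 < eta ->
  exists z' f', [/\ valid z', follows z z', Lip1 d f', functions z' f' & supdist_lt d f f' eta].
Proof.
move=> [e1 /andP[al0 _] Dcone Sbig _ f_scales] fL Uf eta0.
set n := level z in Dcone f_scales *; have c0 := tolerance_gt0 n.
pose rho := Num.min (eta / 4) (scale z).
have rho_eta : 4 * rho <= eta by rewrite mulrC -ler_pdivlMr // ge_min lexx.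
have rho_itv : 0 < rho <= scale z by rewrite lt_min al0 divr_gt0 //= ge_min lexx orbT.
have [x xS fx] := f_scales f fL Uf rho (andP rho_itv).1.
have xcube := eclosure_codes_cube xS.
have [f' [f'L ff' f'_eq f'_near]] := affine_modification fL xcube e1 eta0 rho_eta fx.
have [D' [S' [e' [[D'D D'cone e'1 S'big] [S'S S'digits S'near]]]]] := refine_codes n Sbig
  (fun v Dv => (Dcone v Dv).1) xS (aperture_gt0 n.+1) (divr_gt0 (andP rho_itv).1 (ltr0Sn _ 1)).
have D'cone0 := subset_trans D'D Dcone.
have [|al1 [r1 [al10 r10 f'_scales]]] := near_affine_almost_affine
  (nowhere_coverableW S'big) e1 e'1 D'cone0 D'cone (f := f') (c := f x) (x := x).
  move=> y yS'; apply: f'_eq; first exact: eclosure_codes_cube yS'.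
  by have := S'near y yS'; case/andP: rho_itv => /=; lra.
pose al' := Num.min (tolerance n.+1) (al1 / 2).
have al'0 : 0 < al' by rewrite lt_min tolerance_gt0 divr_gt0.
pose r := Num.min r1 (tolerance n * al').
have r0 : 0 < r by rewrite lt_min r10 mulr_gt0.
exists (Position n.+1 [set h | supdist_lt d f' h r] S' D' e' al'), f'; split=> //.
- split=> //=; [by rewrite al'0 ge_min lexx|exact: lip_open_ball|].
  move=> h hL f'h rho' rho'0.
  have f'h1 : supdist_lt d f' h r1 by apply: supdist_ltW f'h; rewrite ge_min lexx.
  have [y yS' hy] := f'_scales h hL f'h1 rho' rho'0; exists y => // y' y'cube /andP[lo hi].
  have al'_al1 : al' <= al1 / 2 by rewrite ge_min lexx orbT.
  by apply: hy => //; rewrite lo; lra.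
- split=> //= h x' hL [r' r'r f'h] x'S'.
  have r'_small : r' <= tolerance n * al'.
    by apply: ltW; apply: lt_le_trans r'r _; rewrite ge_min lexx orbT.
  apply: almost_affine_perturb rho_itv (S'near x' x'S') r'_small f'_eq f'_near f'h.
    exact: ltW.
  exact: eclosure_codes_cube x'S'.
- exact: supdist_lt_refl.
Qed.

Lemma opening_position : ~ coverable [set v | v != 0] (range g) ->
  exists z0, [/\ valid z0, level z0 = 0%N & functions z0 = setT].
Proof.
move=> ncov.
have [D [E [e [Dneq0 E_sub e1 Dcone ncovE]]]] :=
  not_coverable_cone (aperture_gt0 0) (fun v => id) ncov.
have [|S _ Sbig] := @nowhere_coverable_kernel D (g @^-1` E).
  apply: contra_not ncovE; apply: coverableS => // y Ey; have [s _ gs] := E_sub y Ey.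
  by exists s => //; rewrite /preimage /= gs.
exists (Position 0 setT S D e (tolerance 0)); split=> //; split=> //=.
- by rewrite tolerance_gt0 lexx.
- by move=> f _ _; exists 1.
move=> f fL _ rho rho0; have [[s Ss] _] := Sbig.
exists (g s); first by apply: subset_eclosure; exists s.
move=> y ycube _; have := ler_normB (f y - f (g s)) (dotp e (y - g s)).
have := fL y (g s) ycube (gcube s); have := normr_dotp_unit (y - g s) e1.
have -> : tolerance 0 = 1 by rewrite /tolerance /= invr1.
by have := enorm_ge0 (y - g s); lra.
Qed.

Lemma play_differentiable f (zs : nat -> position d) :
  (forall s, open_cube d (g s)) -> Lip1 d f -> level (zs 0%N) = 0%N ->
  (forall n, valid (zs n)) -> (forall n, functions (zs n) f) ->
  (forall n, follows (zs n) (zs n.+1)) ->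
  exists s v, has_gradient d f (g s) v /\ enorm v = 1.
Proof.
move=> gopen fL level0 zs_valid zs_f zs_follows.
have levelE n : level (zs n) = n.
  by elim: n => // n IH; rewrite (follows_level (zs_follows n)) IH.
have [s s_cl] : exists s, forall n, eclosure (g @` codes (zs n)) (g s).
  apply: nested_codes_limit => // [n|n|n s t k ns nt kn].
  - exact: follows_codes (zs_follows n).
  - by have [] := valid_codes (zs_valid n).
  - by apply: (follows_digits (zs_follows n)) ns nt _; rewrite levelE.
have D_decr := subset_decreasing (fun n => follows_velocities (zs_follows n)).
have axis_cauchy m n : (m <= n)%N -> enorm (axis (zs m) - axis (zs n)) <= 2 * aperture m.
  move=> mn; have ncov := nowhere_coverableW (valid_codes (zs_valid n)).
  have [_ [v Dv]] := not_coverable_nonempty ncov.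
  have Dmv := D_decr m n mn v Dv.
  have := cone_axes_dist (valid_cone (zs_valid m) Dmv) (valid_cone (zs_valid n) Dv).
  by rewrite !levelE; have := aperture_le mn; lra.
have [||v v1 axis_v] := cauchy_rate_unit_limit axis_cauchy.
- by rewrite -(mulr0 2); apply: cvgM; [exact: cvg_cst|exact: cvg_aperture].
- by move=> n; exact: valid_axis.
exists s, v; split=> //; apply: (has_gradient_of_scales (e := fun n => axis (zs n))
  (c := fun n => 8 * tolerance n) (al := fun n => scale (zs n))) => //.
- by move=> n; case/andP: (valid_scale (zs_valid n)).
- apply: squeeze_cvgr (cvg_cst _) cvg_harmonic; apply: nearW => n.
  by have /andP[/ltW] := valid_scale (zs_valid n); rewrite levelE => -> ->.
- by rewrite -(mulr0 8); apply: cvgM; [exact: cvg_cst|exact: cvg_harmonic].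
move=> n; have := follows_affine (zs_follows n) fL (zs_f n.+1) (s_cl n.+1).
by rewrite levelE.
Qed.

End Strategy.

Theorem theorem2p5 (d : nat) (A : set 'rV[R]_d) :
  leq 1 d ->
  A `<=` open_cube d ->
  analytic d A ->
  ~ (exists P : set 'rV[R]_d,
       [/\ Fsigma d P, purely_unrectifiable d P & A `<=` P]) ->
  lip_residual d
    [set f | exists2 x, A x &
       exists v : 'rV[R]_d, has_gradient d f x v /\ enorm v = 1].
Proof.
move=> _ Aopen analyticA not_cov.
have ncov : ~ coverable [set v | v != 0] A by move/coverable_purely_unrectifiable.
case: analyticA => [A0|[g [gcont Ag]]].
  by exfalso; apply: ncov; rewrite A0; exact: coverable_set0r.
have gopen s : open_cube d (g s) by apply: Aopen; rewrite Ag; exists s.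
have gcube s : cube d (g s) by move=> i; have /andP[/ltW-> /ltW->] := gopen s i.
have [|z0 [z0_valid level0 functions0]] := opening_position gcube; first by rewrite -Ag.
apply: (banach_mazur (Z := {z | valid g z}) (moves := fun z z' => follows g (sval z) (sval z'))
  (U := fun z => functions (sval z)) (z0 := exist _ z0 z0_valid)).
- by move=> [z z_valid]; exact: valid_open z_valid.
- by move=> f _; rewrite /= functions0.
- move=> [z z_valid] f eta fL Uf eta0.
  have [z' [f' [z'_valid *]]] := winning_move gcube gcont z_valid fL Uf eta0.
  by exists (exist _ z' z'_valid), f'.
move=> f zs fL zs0 play.
have [||n|n|s [v fv]] := play_differentiable gcont (zs := sval \o zs) gopen fL.
- by rewrite /= zs0.
- by move=> n; exact: svalP.
- by case: (play n).
- by case: (play n).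
by exists (g s); [rewrite Ag; exists s|exists v].
Qed.
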